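(* Let $d\ge3$ be an integer, $p_1,\dots,p_d\in(0,1)$, $J^d$ the first rencontre-time, $\mu=E(J^d\mid J^d<\infty)$, $t\in(1,\infty)$, and $\lambda_1,\lambda_2\in(0,1)$ arbitrary. If $p_1,\dots,p_d$ are not all the same or $d\ge6$, then, with $UB$ and $LB$ as defined in the context, $$E\left(J^d\,\Big|\,\frac{\mu}{t}<J^d<\infty\right)\le\frac{t^2}{(t-1)^2}\lim_{x\to1-}\left(\frac{UB(x;\lambda_1\mid\varphi_d'+x\varphi_d'')}{LB(x;\lambda_2\mid\varphi_d')}-\frac{LB(x;\lambda_2\mid\varphi_d')}{1+UB(x;\lambda_1\mid\varphi_d)}\right).$$
   Context: Let $\{X^j_k\}_{k\ge1}$, $j=1,\dots,d$, be independent sequences, the $j$-th consisting of i.i.d. Bernoulli random variables with success parameter $p_j$ (all mutually independent); $S^j(n)=\sum_{i=1}^nX^j_i$; $J^d=\inf\{n\ge1:S^1(n)=\dots=S^d(n)\}$ ($\inf\emptyset=\infty$). Let $q_j=1-p_j$, $Q=\prod_jq_j$, $P=\prod_jp_jq_j^{-1}$, $T=Q(1+P^{1/d})^d$, and $r_n=Q^n\sum_{k=0}^n\binom nk^dP^k$. With $[x]$ the greatest integer $\le x$, for $\alpha>0$, $\lambda\in(0,1)$ define $N(\alpha,\lambda)=\max\{[\alpha/\lambda]+1,[1/(\lambda\alpha)]+1\}$, $M(\alpha,\lambda)=\frac{\alpha+1}{\sqrt\alpha(1-\lambda)}$, $L(\alpha,\lambda)=\max\left\{\left[\left(\frac{(\alpha+1)+\sqrt{(\alpha+1)^2+4\lambda\alpha}}{2\lambda\alpha}\right)^2\right]+1,\left[\left(\frac{(\alpha+1)+\sqrt{(\alpha+1)^2+4\lambda\alpha}}{2\lambda}\right)^2\right]+1\right\}$,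 $C_1(\alpha,\lambda)=\max\left\{4,\frac{(\alpha+1)^2}{\alpha(1+\lambda\alpha)}\right\}\exp\!\left(-\frac12\frac{1+\lambda\alpha}{(1-\lambda)\alpha}\left((\alpha+1)^2+\frac{\lambda\alpha}{1+\lambda\alpha}\right)\right)$, $C_2(\alpha,\lambda)=\max\left\{4,\frac{(\alpha+1)^2}{\alpha+\lambda}\right\}\exp\!\left(-\frac12\frac{\alpha+\lambda}{(1-\lambda)\alpha^2}\left((\alpha+1)^2+\frac{\lambda\alpha^2}{\alpha+\lambda}\right)\right)$, $K(\alpha,d,\lambda)=\frac{(1-\lambda)\alpha+1}{\alpha+1}C_1^d+C_2^d$. Writing $N=N(P^{1/d},\lambda)$, $L=L(P^{1/d},\lambda)$, $M=M(P^{1/d},\lambda)$, $K=K(P^{1/d},d,\lambda)$, define for $0<x<1$: $UB(x;\lambda\mid\varphi_d)=\sum_{n=1}^{N-1}r_nx^n+\left(\frac{M}{\sqrt{2\pi}}\right)^{d-1}\sum_{n\ge N}n^{-\frac{d-1}{2}}(Tx)^n$; $LB(x;\lambda\mid\varphi_d')=\sum_{n=1}^{L-1}nr_nx^{n-1}+\left(\frac{\sqrt{2\pi}}{e^2}\right)^dK\sum_{n\ge L}n^{-\frac{d-3}{2}}x^{-1}(Tx)^n$; $UB(x;\lambda\mid\varphi_d'+x\varphi_d'')=\sum_{n=1}^{N-1}n^2r_nx^{n-1}+\left(\frac{M}{\sqrt{2\pi}}\right)^{d-1}\sum_{n\ge N}n^{-\frac{d-5}{2}}x^{-1}(Tx)^n$.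 *)

(* Defs.v *)
From HB Require Import structures.
From mathcomp Require Import all_boot all_order all_algebra.
From mathcomp Require Import all_classical all_reals all_analysis.
Set Implicit Arguments. Unset Strict Implicit. Unset Printing Implicit Defensive.
Import Order.TTheory GRing.Theory Num.Theory.
Import numFieldNormedType.Exports.
Local Open Scope ring_scope.

Section Rencontre.
Variable R : realType.
Variable d : nat.
Variable p : 'I_d -> R.

(* An outcome of the first n trials of the d sequences: w (j, k) = X^j_{k+1}. *)
Definition outcome_weight n (w : {ffun 'I_d * 'I_n -> bool}) : R :=
  \prod_(j < d) \prod_(k < n) (if w (j, k) then p j else 1 - p j).

Definition Spart n (w : {ffun 'I_d * 'I_n -> bool}) (j : 'I_d) (m : nat) : nat :=
  \sum_(k < n | (k < m)%N) (w (j, k) : nat).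

Definition all_equal_at n (w : {ffun 'I_d * 'I_n -> bool}) (m : nat) : bool :=
  [forall j : 'I_d, forall j' : 'I_d, Spart w j m == Spart w j' m].

Definition first_rencontre_at n (w : {ffun 'I_d * 'I_n -> bool}) : bool :=
  (0 < n)%N && all_equal_at w n &&
  [forall m : 'I_n, (0 < m)%N ==> ~~ all_equal_at w m].

Definition probJ (n : nat) : R :=
  \sum_(w : {ffun 'I_d * 'I_n -> bool} | first_rencontre_at w) outcome_weight w.

Local Open Scope ereal_scope.
Definition probJfin : \bar R := \sum_(0 <= n <oo) (probJ n)%:E.
Definition expJfin : \bar R := \sum_(0 <= n <oo) (n%:R * probJ n)%:E.
Definition muJ : \bar R := expJfin * ((fine probJfin)^-1)%:E.

Definition condE_tail (t : R) : \bar R :=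
  (\sum_(0 <= n <oo) (if muJ * (t^-1)%:E < (n%:R)%:E then (n%:R * probJ n)%:E else 0))
  * ((fine (\sum_(0 <= n <oo)
        (if muJ * (t^-1)%:E < (n%:R)%:E then (probJ n)%:E else 0)))^-1)%:E.
Local Close Scope ereal_scope.

Definition qq (j : 'I_d) : R := 1 - p j.
Definition QQ : R := \prod_(j < d) qq j.
Definition PP : R := \prod_(j < d) (p j / qq j).
Definition alphaP : R := PP `^ (d%:R^-1).
Definition TT : R := QQ * (1 + alphaP) ^+ d.
Definition rr (n : nat) : R :=
  QQ ^+ n * \sum_(0 <= k < n.+1) ((('C(n, k))%:R) ^+ d * PP ^+ k).

Definition Nc (a l : R) : nat :=
  maxn (Num.truncn (a / l)).+1 (Num.truncn (1 / (l * a))).+1.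
Definition Mc (a l : R) : R := (a + 1) / (Num.sqrt a * (1 - l)).
Definition Lc (a l : R) : nat :=
  let s := (a + 1) + Num.sqrt ((a + 1) ^+ 2 + 4 * l * a) in
  maxn (Num.truncn ((s / (2 * l * a)) ^+ 2)).+1 (Num.truncn ((s / (2 * l)) ^+ 2)).+1.
Definition C1c (a l : R) : R :=
  Num.max 4 ((a + 1) ^+ 2 / (a * (1 + l * a))) *
  expR (- (1/2) * ((1 + l * a) / ((1 - l) * a)) *
        ((a + 1) ^+ 2 + (l * a) / (1 + l * a))).
Definition C2c (a l : R) : R :=
  Num.max 4 ((a + 1) ^+ 2 / (a + l)) *
  expR (- (1/2) * ((a + l) / ((1 - l) * a ^+ 2)) *
        ((a + 1) ^+ 2 + (l * a ^+ 2) / (a + l))).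
Definition Kc (a : R) (dd : nat) (l : R) : R :=
  ((1 - l) * a + 1) / (a + 1) * (C1c a l) ^+ dd + (C2c a l) ^+ dd.

Definition npow (n : nat) (e : R) : R := (n%:R) `^ e.

Definition UB_phi (x l : R) : R :=
  let N := Nc alphaP l in
  \sum_(1 <= n < N) rr n * x ^+ n
  + (Mc alphaP l / Num.sqrt (2 * pi)) ^+ d.-1 *
    (limn (fun m => \sum_(N <= n < m) npow n (- ((d%:R - 1) / 2)) * (TT * x) ^+ n)).

Definition LB_dphi (x l : R) : R :=
  let L := Lc alphaP l in
  \sum_(1 <= n < L) n%:R * rr n * x ^+ n.-1
  + (Num.sqrt (2 * pi) / expR 2) ^+ d * Kc alphaP d l *
    (limn (fun m => \sum_(L <= n < m) npow n (- ((d%:R - 3) / 2)) * x^-1 * (TT * x) ^+ n)).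

Definition UB_dphi2 (x l : R) : R :=
  let N := Nc alphaP l in
  \sum_(1 <= n < N) (n ^ 2)%:R * rr n * x ^+ n.-1
  + (Mc alphaP l / Num.sqrt (2 * pi)) ^+ d.-1 *
    (limn (fun m => \sum_(N <= n < m) npow n (- ((d%:R - 5) / 2)) * x^-1 * (TT * x) ^+ n)).

Definition bound_fun (l1 l2 x : R) : R :=
  UB_dphi2 x l1 / LB_dphi x l2 - LB_dphi x l2 / (1 + UB_phi x l1).

End Rencontre.

(* Main.v *)
(* Let f_n = P(J^d = n). Splitting at the first rencontre gives the renewal
   equation r = delta_0 + f * r, so that the moments A_i = sum n^i r_n and
   B_i = sum n^i f_n satisfy B_0 = 1 - 1/A_0, B_1 = A_1 / A_0^2 and
   B_2 / B_1 = A_2 / A_1 - 2 A_1 / A_0. A second moment argument bounds the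
   conditional expectation by t / (t - 1) * B_2 / B_1.

   The bounds on the A_i come from r_n = T^n sum_k b(n, k)^d, where the b(n, k)
   are the binomial probabilities of parameter a / (1 + a), a = P^(1/d). The sum
   is at most (max_k b(n, k))^(d-1), and Stirling's formula with its exact constant
   (obtained from Wallis' product) bounds the mode; in the other direction
   Chebyshev's inequality shows that most of the mass lies in a window of
   O(sqrt n) integers, which beats the constant K.

   By the arithmetic-geometric inequality T <= 1, with equality only if all p_j
   agree. Hence all series converge at x = 1, and the limit is the value there,
   unless T = 1 and d is 6 or 7; in that case the limit is +oo. *)
Require Import Defs.
From HB Require Import structures.
From mathcomp Require Import all_boot all_order all_algebra.
From mathcomp Require Import all_classical all_reals all_analysis.
From mathcomp Require Import ring lra.
Set Implicit Arguments. Unset Strict Implicit. Unset Printing Implicit Defensive.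
Import Order.TTheory GRing.Theory Num.Theory.
Import numFieldNormedType.Exports.
Local Open Scope ring_scope.
Local Open Scope classical_set_scope.

(** * The renewal equation *)

Section Renewal.
Variables (R : realType) (d : nat) (p : 'I_d -> R).

(** The two constants of the statement leave very different room. In M / sqrt (2 pi) the only slack
    is the factor 1 - lambda, spent on locating the mode; no Stirling error factor may appear. Since
    n! / (sqrt n (n / e)^n) decreases to sqrt (2 pi), n! is compared with k! by monotonicity and (n
    - k)! with the limit, both without error. The lower constant is small: C_1 and C_2 are at most 4
    e^(-2), so (sqrt (2 pi) / e^2)^d K <= 2 / 4^d, while the Chebyshev window gives 3 / 4^d. The
    exponents -(d - 1)/2, -(d - 3)/2, -(d - 5)/2 are halves of integers, so for T = 1 a tail
    converges exactly when its exponent is at most -3/2; with d >= 6 only the last one can fail. The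
    moments give the factor t / (t - 1) and the term 2 A_1 / A_0; the stated bound follows since t /
    (t - 1) > 1, B_2 / B_1 >= 0 and A_1 / A_0 >= 0. *)

Definition prob_all_equal (n : nat) : R :=
  \sum_(w : {ffun 'I_d * 'I_n -> bool} | all_equal_at w n) outcome_weight p w.

(** The event of [first_rencontre_at] for a separate time m, read off an outcome of length n: the
    renewal argument fixes n and lets m vary. *)
Definition first_equal_at n (w : {ffun 'I_d * 'I_n -> bool}) (m : nat) : bool :=
  (0 < m)%N && all_equal_at w m &&
  [forall l : 'I_m, (0 < l)%N ==> ~~ all_equal_at w l].

Definition join_outcomes m k (u : {ffun 'I_d * 'I_m -> bool})
    (v : {ffun 'I_d * 'I_k -> bool}) : {ffun 'I_d * 'I_(m + k) -> bool} :=
  [ffun x => match fintype.split x.2 with inl a => u (x.1, a) | inr b => v (x.1, b) end].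

Lemma join_outcomesl m k u v j (i : 'I_m) :
  @join_outcomes m k u v (j, lshift k i) = u (j, i).
Proof. by rewrite ffunE /= -[lshift k i]/(unsplit (inl i)) unsplitK. Qed.

Lemma join_outcomesr m k u v j (i : 'I_k) :
  @join_outcomes m k u v (j, rshift m i) = v (j, i).
Proof. by rewrite ffunE /= -[rshift m i]/(unsplit (inr i)) unsplitK. Qed.

Lemma Spart_join_le m k u v j l : (l <= m)%N ->
  Spart (@join_outcomes m k u v) j l = Spart u j l.
Proof.
move=> lm; rewrite /Spart big_split_ord /= [X in (_ + X)%N]big_pred0 ?addn0.
  by apply: eq_bigr => i _; rewrite join_outcomesl.
by move=> i /=; rewrite ltnNge (leq_trans lm) ?leq_addr.
Qed.

Lemma Spart_join m k u v j :
  Spart (@join_outcomes m k u v) j (m + k) = (Spart u j m + Spart v j k)%N.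
Proof.
rewrite /Spart big_split_ord /=; congr (_ + _)%N.
  rewrite [RHS](eq_bigl xpredT); last by move=> i; rewrite ltn_ord.
  by apply: eq_big => i; rewrite ?join_outcomesl // ltn_addr.
rewrite [RHS](eq_bigl xpredT); last by move=> i; rewrite ltn_ord.
by apply: eq_big => i; rewrite ?join_outcomesr // ltn_add2l ltn_ord.
Qed.

Lemma all_equal_at_join_le m k u v l : (l <= m)%N ->
  all_equal_at (@join_outcomes m k u v) l = all_equal_at u l.
Proof.
move=> lm; apply: eq_forallb => j; apply: eq_forallb => j'.
by rewrite !Spart_join_le.
Qed.

Lemma all_equal_at_join m k u v : all_equal_at u m ->
  all_equal_at (@join_outcomes m k u v) (m + k) = all_equal_at v k.
Proof.
move=> /forallP um; apply: eq_forallb => j; apply: eq_forallb => j'.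
by rewrite !Spart_join (eqP (forallP (um j) j')) eqn_add2l.
Qed.

Lemma first_equal_at_join m k u v :
  first_equal_at (@join_outcomes m k u v) m = first_rencontre_at u.
Proof.
rewrite /first_equal_at /first_rencontre_at all_equal_at_join_le //.
congr (_ && _); apply: eq_forallb => l.
by rewrite all_equal_at_join_le // ltnW.
Qed.

Lemma outcome_weight_join m k u v :
  outcome_weight p (@join_outcomes m k u v) = outcome_weight p u * outcome_weight p v.
Proof.
rewrite /outcome_weight -big_split /=; apply: eq_bigr => j _.
rewrite big_split_ord /=; congr (_ * _); apply: eq_bigr => i _;
  by rewrite ?join_outcomesl ?join_outcomesr.
Qed.

Lemma join_outcomes_bij m k :
  bijective (fun x : {ffun 'I_d * 'I_m -> bool} * {ffun 'I_d * 'I_k -> bool} =>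
    join_outcomes x.1 x.2).
Proof.
exists (fun w : {ffun 'I_d * 'I_(m + k) -> bool} =>
  ([ffun x => w (x.1, lshift k x.2)], [ffun x => w (x.1, rshift m x.2)])).
  move=> [u v] /=; congr (_, _); apply/ffunP => -[j i]; rewrite !ffunE /=.
    by rewrite -[lshift k i]/(unsplit (inl i)) unsplitK.
  by rewrite -[rshift m i]/(unsplit (inr i)) unsplitK.
move=> w; apply/ffunP => -[j i]; rewrite ffunE /=.
by case: (splitP i) => l il; rewrite ffunE /=; congr (w (j, _)); apply: val_inj.
Qed.

(** Cutting at time m is a bijection onto pairs of outcomes, under which weights multiply. Once the
    counts agree at m, they agree at m + k exactly when the counts of the second piece agree. *)
Lemma sum_first_equal_at m k :
  \sum_(w : {ffun 'I_d * 'I_(m + k) -> bool} |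
      first_equal_at w m && all_equal_at w (m + k)) outcome_weight p w
  = probJ p m * prob_all_equal k.
Proof.
rewrite (reindex _ (onW_bij _ (join_outcomes_bij m k))) /=.
rewrite /probJ /prob_all_equal big_distrlr /=.
rewrite pair_big_dep /=; apply: eq_big => -[u v] /=; last first.
  by move=> _; rewrite outcome_weight_join.
rewrite first_equal_at_join.
case fu: (first_rencontre_at u) => //=.
by rewrite all_equal_at_join //; case/andP: fu => /andP[].
Qed.

(** Existence and uniqueness of a first time, as a sum of indicators by which weights can be
    multiplied. *)
Lemma sum_first_equal_time n (w : {ffun 'I_d * 'I_n -> bool}) :
  (0 < n)%N -> all_equal_at w n ->
  (\sum_(m < n.+1) (first_equal_at w m : nat))%N = 1%N.
Proof.
move=> n0 wn.
have ex : exists m, (0 < m)%N && all_equal_at w m by exists n; rewrite n0 wn.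
have [m /andP[m0 wm] minm] := ex_minnP ex.
have mn : (m < n.+1)%N by rewrite ltnS minm ?n0.
rewrite (bigD1 (Ordinal mn)) //= big1 ?addn0.
  rewrite /first_equal_at m0 wm /=.
  case: forallP => // -[] l; apply/implyP => l0; apply/negP => wl.
  by have := minm l; rewrite l0 wl => /(_ isT); rewrite leqNgt ltn_ord.
move=> i /eqP im; case fi: (first_equal_at w i) => //; exfalso; apply: im.
case/andP: fi => /andP[i0 wi] /forallP fi; apply: val_inj => /=.
apply/eqP; rewrite eqn_leq (minm i) ?i0 ?wi // andbT leqNgt; apply/negP => lim.
by have := fi (Ordinal lim); rewrite /= m0 wm.
Qed.

Lemma prob_all_equal_renewal n : prob_all_equal n =
  (n == 0%N)%:R + \sum_(0 <= m < n.+1) probJ p m * prob_all_equal (n - m).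
Proof.
have J0 : probJ p 0 = 0.
  by rewrite /probJ big_pred0 // => w; rewrite /first_rencontre_at.
case: n => [|n].
  rewrite big_nat1 J0 mul0r addr0 /prob_all_equal.
  (* The only outcome of length 0 has weight 1 and satisfies [all_equal_at] trivially: this is the
     term delta_0. *)
  have e0 : (#|{ffun 'I_d * 'I_0 -> bool}| = 1)%N.
    by rewrite card_ffun card_prod !card_ord muln0 expn0.
  have [w0 w0E] := @fintype1 {ffun 'I_d * 'I_0 -> bool} e0.
  rewrite (big_pred1 w0) => [|w]; last first.
    rewrite /= (w0E w) eqxx; apply/forallP => j; apply/forallP => j'.
    by rewrite /Spart !big_ord0.
  by rewrite /outcome_weight big1 // => j _; rewrite big_ord0.
rewrite add0r big_mkord.
transitivity (\sum_(m < n.+2) \sum_(w : {ffun 'I_d * 'I_n.+1 -> bool} |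
   first_equal_at w m && all_equal_at w n.+1) outcome_weight p w).
  under [RHS]eq_bigr do rewrite big_mkcond /=.
  rewrite exchange_big /= /prob_all_equal big_mkcond /=; apply: eq_bigr => w _.
  case: ifPn => wn; last by rewrite big1 // => m _; rewrite andbF.
  have /(congr1 (fun k : nat => k%:R : R)) := sum_first_equal_time (ltn0Sn n) wn.
  rewrite natr_sum => sw; rewrite -[LHS]mulr1 -[X in _ * X]/(1%:R) -sw.
  rewrite mulr_sumr; apply: eq_bigr => m _.
  by case: ifP; rewrite ?andbT => ->; rewrite (mulr1, mulr0).
apply: eq_bigr => m _; rewrite -sum_first_equal_at.
by rewrite (@subnKC m n.+1) // -ltnS.
Qed.

(** * Closed form of the probability that all counts agree *)

Lemma sum_bernoulli_weight (q : R) n s :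
  \sum_(v : {ffun 'I_n -> bool} | (\sum_(i < n) (v i : nat))%N == s)
     \prod_(i < n) (if v i then q else 1 - q)
  = 'C(n, s)%:R * (q ^+ s * (1 - q) ^+ (n - s)).
Proof.
have bij : bijective (fun A : {set 'I_n} => [ffun i => i \in A]).
  exists (fun v : {ffun 'I_n -> bool} => [set i | v i]%SET).
    by move=> A; apply/setP => i; rewrite !inE ffunE.
  by move=> v; apply/ffunP => i; rewrite ffunE inE.
rewrite (reindex _ (onW_bij _ bij)) /=.
have cardE (A : {set 'I_n}) :
    (\sum_(i < n) ([ffun i => i \in A] i : nat))%N = #|A|.
  by rewrite -sum1_card [RHS]big_mkcond /=; apply: eq_bigr => i _; rewrite ffunE; case: (i \in A).
rewrite (eq_bigr (fun=> q ^+ s * (1 - q) ^+ (n - s))) => [|A]; last first.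
  rewrite cardE => /eqP As.
  under eq_bigr do rewrite ffunE.
  rewrite big_if /= !prodr_const As; congr (_ * _ ^+ _).
  by rewrite -As -[X in (X - _)%N]card_ord -(cardC A) addKn; apply: eq_card.
rewrite big_const iter_addr_0 -[LHS]mulr_natl; congr (_ * _); congr (_%:R).
have := card_draws 'I_n s; rewrite card_ord => <-; apply: eq_card => A.
by rewrite !inE unfold_in cardE.
Qed.

(** For a given common count s, read off the sequence [j0], independence gives the product over j of
    C(n, s) p_j^s q_j^(n - s). Taking out q_j^n, with q_j nonzero, leaves (p_j / q_j)^s. *)
Lemma prob_all_equalE n : (0 < d)%N -> (forall j, p j != 1) -> prob_all_equal n = rr p n.
Proof.
move=> d0 p1; have [j0 _] : exists j0 : 'I_d, True by exists (Ordinal d0).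
have SE (w : {ffun 'I_d * 'I_n -> bool}) j : Spart w j n = (\sum_(i < n) (w (j, i) : nat))%N.
  by rewrite /Spart; apply: eq_bigl => i; rewrite ltn_ord.
have Sle (w : {ffun 'I_d * 'I_n -> bool}) : (Spart w j0 n < n.+1)%N.
  rewrite SE ltnS (leq_trans (leq_sum _ (fun i _ => leq_b1 _))) //.
  by rewrite sum_nat_const card_ord muln1.
rewrite /prob_all_equal (partition_big (fun w => inord (Spart w j0 n) : 'I_n.+1) xpredT) //=.
rewrite /rr mulr_sumr big_mkord; apply: eq_bigr => s _.
have bij : bijective (fun g : {ffun 'I_d -> {ffun 'I_n -> bool}} =>
    [ffun x : 'I_d * 'I_n => g x.1 x.2]).
  exists (fun w : {ffun 'I_d * 'I_n -> bool} => [ffun j => [ffun i => w (j, i)]]).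
    by move=> g; apply/ffunP => j; apply/ffunP => i; rewrite !ffunE.
  by move=> w; apply/ffunP => -[j i]; rewrite !ffunE.
rewrite (reindex _ (onW_bij _ bij)) /=.
transitivity (\prod_(j < d) \sum_(v : {ffun 'I_n -> bool} | (\sum_(i < n) (v i : nat))%N == s)
     \prod_(i < n) (if v i then p j else 1 - p j)).
  rewrite bigA_distr_big_dep /=; apply: eq_big => [g|g _]; last first.
    by apply: eq_bigr => j _; apply: eq_bigr => i _; rewrite ffunE.
  have SgE j : Spart [ffun x => g x.1 x.2] j n = (\sum_(i < n) (g j i : nat))%N.
    by rewrite SE; apply: eq_bigr => i _; rewrite ffunE.
  apply/andP/familyP => [[/forallP eqs /eqP sE] j|gs].
    rewrite unfold_in -SgE (eqP (forallP (eqs j) j0)) -sE inordK //.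
  have {}gs j : Spart [ffun x => g x.1 x.2] j n = s.
    by have := gs j; rewrite unfold_in -SgE => /eqP.
  split; last by apply/eqP/val_inj; rewrite /= gs inord_val.
  by apply/forallP => j; apply/forallP => j'; rewrite !gs.
under eq_bigr do rewrite sum_bernoulli_weight.
rewrite !big_split /= prodr_const card_ord [RHS]mulrCA; congr (_ * _).
rewrite /QQ /PP -!prodrXl -!big_split /=; apply: eq_bigr => j _.
rewrite expr_div_n /qq mulrCA; congr (_ * _).
have q0 : 1 - p j != 0 by rewrite subr_eq0 eq_sym.
have -> : (1 - p j) ^+ n = (1 - p j) ^+ (n - s) * (1 - p j) ^+ s.
  by rewrite -exprD subnK // -ltnS.
by rewrite mulfK // expf_neq0.
Qed.

End Renewal.

(** * Stirling bounds *)

Section Wallis.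
Variable R : realType.
Implicit Types x : R.

Lemma derive_ge0_le (f df : R -> R) (a b : R) : a <= b ->
  (forall x, is_derive x 1 f (df x)) ->
  (forall x, a <= x <= b -> 0 <= df x) -> f a <= f b.
Proof.
move=> ab fdf df0.
have fc : {within `[a, b], continuous f}.
  apply: continuous_subspaceT => x; apply: differentiable_continuous.
  by apply/derivable1_diffP; exact: ex_derive.
have [x xab fab] := MVT_segment ab (fun x _ => fdf x) fc.
by rewrite -subr_ge0 fab mulr_ge0 ?subr_ge0 // df0 // -in_itv.
Qed.

(** The primitive of cos^n vanishing at 0, obtained by integration by parts. With explicit
    primitives, integrals become values at pi / 2, compared by [derive_ge0_le]. *)
Fixpoint cos_primitive (n : nat) : R -> R :=
  match n with
  | 0 => id
  | 1 => @sin R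
  | (m.+1 as k).+1 =>
      k.+1%:R^-1 \*: (@cos R ^+ k * @sin R) + (k%:R / k.+1%:R) \*: cos_primitive m
  end.

Lemma cos_primitiveSS n x : cos_primitive n.+2 x =
  n.+2%:R^-1 * (cos x ^+ n.+1 * sin x) + n.+1%:R / n.+2%:R * cos_primitive n x.
Proof. by rewrite [cos_primitive n.+2]/= !fctE. Qed.

Lemma is_derive_cos_primitive n x : is_derive x 1 (cos_primitive n) (cos x ^+ n).
Proof.
have [k kn] := ubnP n; elim: k => // k IH in n kn *.
case: n kn => [|[|n]] kn.
- by rewrite expr0; exact: is_derive_id.
- by rewrite expr1; exact: is_derive_sin.
have h := IH n (ltn_trans (ltnSn n) kn).
rewrite [cos_primitive _]/=.
apply: is_derive_eq.
have n2 : n.+2%:R != 0 :> R by rewrite pnatr_eq0.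
rewrite !fctE -[n.+1.-1]/n !exprS /GRing.scale /=.
have s2 : sin x * sin x = 1 - cos x * cos x by rewrite -!expr2 -sin2cos2.
transitivity (n.+2%:R^-1 * (cos x * (cos x * cos x ^+ n)
    - n.+1%:R * cos x ^+ n * (sin x * sin x) + n.+1%:R * cos x ^+ n)).
  by field.
apply: (mulfI n2); rewrite [LHS]mulrA mulfV // mul1r s2 -[n.+2%:R]natr1; ring.
Qed.

Lemma cos_primitive0 n : cos_primitive n 0 = 0.
Proof.
have [k kn] := ubnP n; elim: k => // k IH in n kn *.
case: n kn => [|[|n]] kn; [by []|exact: sin0|].
rewrite cos_primitiveSS sin0 !mulr0 add0r IH ?mulr0 //.
exact: ltn_trans (ltnSn n) kn.
Qed.

(* The integral of [cos ^+ n] over [0, pi / 2], through its reduction formula. *)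
Definition wallis n := cos_primitive n (pi / 2 : R).

Lemma wallisSS n : wallis n.+2 = n.+1%:R / n.+2%:R * wallis n.
Proof. by rewrite /wallis cos_primitiveSS cos_pihalf expr0n mul0r mulr0 add0r. Qed.

Lemma cos01_pihalf x : 0 <= x <= pi / 2 -> 0 <= cos x <= 1.
Proof.
move=> /andP[x0 x1]; rewrite cos_le1 andbT cos_ge0_pihalf // x1 andbT.
by rewrite (le_trans _ x0) // oppr_le0 divr_ge0 // pi_ge0.
Qed.

Lemma wallis_ge0 n : 0 <= wallis n.
Proof.
rewrite -(cos_primitive0 n); apply: (derive_ge0_le _ (is_derive_cos_primitive n)).
  by rewrite divr_ge0 // pi_ge0.
by move=> x /cos01_pihalf/andP[c0 _]; rewrite exprn_ge0.
Qed.

Lemma wallisS_le n : wallis n.+1 <= wallis n.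
Proof.
rewrite -subr_ge0.
have := @derive_ge0_le (fun x => cos_primitive n x - cos_primitive n.+1 x)
  (fun x => cos x ^+ n - cos x ^+ n.+1) 0 (pi / 2).
rewrite !cos_primitive0 subrr; apply.
- by rewrite divr_ge0 // pi_ge0.
- move=> x; have ? := is_derive_cos_primitive n x.
  have ? := is_derive_cos_primitive n.+1 x; exact: is_deriveB.
move=> x /cos01_pihalf/andP[c0 c1]; rewrite subr_ge0 exprS.
by rewrite ler_piMl // exprn_ge0.
Qed.

(** By the reduction formula (n + 1) W_(n+1) W_n does not depend on n; at n = 0 it is pi / 2. *)
Lemma wallisM n : wallis n.+1 * wallis n = pi / (2 * n.+1%:R).
Proof.
elim: n => [|n IH]; first by rewrite /wallis /= sin_pihalf mul1r mulr1.
rewrite wallisSS -(mulrA _ (wallis n)) [wallis n * _]mulrC IH.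
have n1 : n.+1%:R != 0 :> R by rewrite pnatr_eq0.
have n2 : n.+2%:R != 0 :> R by rewrite pnatr_eq0.
by move: n.+1%:R n.+2%:R n1 n2 => a b a0 b0; field; rewrite a0 b0.
Qed.

Lemma wallis_even n :
  wallis n.*2 = pi / 2 * ((n.*2)`!%:R / (4 ^+ n * n`!%:R ^+ 2)).
Proof.
elim: n => [|n IH]; first by rewrite /wallis /= expr0 fact0 expr1n mulr1 divr1 mulr1.
rewrite doubleS wallisSS IH !factS !natrM [4 ^+ n.+1]exprS.
have n1 : n.+1%:R != 0 :> R by rewrite pnatr_eq0.
have n2 : n.*2.+2%:R != 0 :> R by rewrite pnatr_eq0.
have f : n`!%:R != 0 :> R by rewrite pnatr_eq0 -lt0n fact_gt0.
have f4 : 4 ^+ n != 0 :> R by rewrite expf_neq0.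
have -> : n.*2.+2%:R = 2 * n.+1%:R :> R by rewrite -doubleS -muln2 natrM mulrC.
by move: n.+1%:R n.*2.+1%:R n`!%:R (4 ^+ n) n1 f f4 => a b c e a0 c0 e0; field; rewrite a0 c0 e0.
Qed.

(** With c = C(2n, n) / 4^n, W_(2n) = (pi / 2) c, and W_(2n)^2 <= W_(2n) W_(2n-1) = pi / (4n)
    because W decreases. *)
Lemma central_binomial_le n : (0 < n)%N ->
  pi * n%:R * ((n.*2)`!%:R / (4 ^+ n * n`!%:R ^+ 2)) ^+ 2 <= 1 :> R.
Proof.
case: n => // n _; set c := _ / _.
have pi0 := pi_gt0 R.
have : wallis n.+1.*2 * wallis n.+1.*2 <= wallis n.+1.*2 * wallis n.*2.+1.
  by rewrite ler_wpM2l ?wallis_ge0 // doubleS wallisS_le.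
rewrite {3}doubleS wallisM wallis_even -/c.
have -> : n.*2.+2%:R = 2 * n.+1%:R :> R by rewrite -doubleS -muln2 natrM mulrC.
have n1 : 0 < n.+1%:R :> R by rewrite ltr0n.
rewrite ler_pdivlMr ?mulr_gt0 // => h.
rewrite -(ler_pM2l pi0) mulr1; apply: le_trans h.
by rewrite le_eqVlt; apply/orP; left; apply/eqP; field.
Qed.

End Wallis.

(** * Stirling's formula by monotone sequences *)

Section Stirling.
Variable R : realType.

(** Compares e^y with its Pade approximant (2 + y) / (2 - y), whose value at y = 1 / (n + 1/2) is (n
    + 1) / n. The difference has a nonnegative derivative because 1 - y <= e^(-y). *)
Lemma expR_pade (y : R) : 0 <= y -> expR y * (2 - y) <= 2 + y.
Proof.
move=> y0; rewrite -subr_ge0.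
have := @derive_ge0_le R (fun y => (2 + y) - expR y * (2 - y))
  (fun y => 1 - (1 - y) * expR y) 0 y y0.
rewrite expR0 mul1r subr0 addr0 subrr; apply.
  move=> x.
  have d1 : is_derive x 1 (cst 2 + id : R -> R) (0 + 1) by exact: is_deriveD.
  have d2 : is_derive x 1 (cst 2 - id : R -> R) (0 - 1) by exact: is_deriveB.
  have d3 := is_deriveB d1 (is_deriveM (is_derive_expR x) d2).
  by apply: (is_derive_eq d3); rewrite !fctE /GRing.scale /=; ring.
move=> x /andP[x0 _]; rewrite subr_ge0 -[leRHS](expRxMexpNx_1 x) mulrC.
by rewrite ler_pM2l ?expR_gt0 // expR_ge1Dx.
Qed.

(** This is z <= sinh z, cleared of e^(-z). It bounds ln ((n + 1) / n) from above, and e^(2z) from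
    below in terms of e^z. *)
Lemma expR_sinh (z : R) : 0 <= z -> 2 * z * expR z <= expR z ^+ 2 - 1.
Proof.
move=> z0; rewrite -subr_ge0 expr2.
have := @derive_ge0_le R (fun z => expR z * expR z - 1 - 2 * z * expR z)
  (fun z => 2 * expR z * (expR z - (1 + z))) 0 z z0.
rewrite expR0 mulr0 mul0r mulr1 !subrr; apply.
  move=> x; have e := is_derive_expR x.
  have d1 := is_deriveM (is_derive_cst (2 : R) x 1) (is_derive_id x (1 : R)).
  have d2 := is_deriveB (is_deriveB (is_deriveM e e) (is_derive_cst (1 : R) x 1)) (is_deriveM d1 e).
  by apply: (is_derive_eq d2); rewrite ?fctE /GRing.scale /=; ring.
by move=> x _; rewrite !mulr_ge0 ?expR_ge0 // subr_ge0 expR_ge1Dx.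
Qed.

Lemma ln_ratio_ge (n : nat) : (0 < n)%N ->
  1 <= (n%:R + 2^-1) * (ln n.+1%:R - ln n%:R) :> R.
Proof.
move=> n0; have n0' : 0 < n%:R :> R by rewrite ltr0n.
pose y : R := (n%:R + 2^-1)^-1.
have y0 : 0 < y by rewrite invr_gt0; lra.
rewrite mulrC -ler_pdivrMr ?div1r -/y; last lra.
rewrite -ln_div ?posrE ?ltr0n // -ler_expR lnK ?posrE ?divr_gt0 ?ltr0n //.
have yE : y * (n%:R + 2^-1) = 1 by rewrite mulVf // gt_eqF //; lra.
have := expR_pade (ltW y0); rewrite -[n.+1%:R]natr1 ler_pdivlMr // => h.
have e0 := expR_gt0 y.
have -> : n%:R = y^-1 - 2^-1 :> R by rewrite invrK; lra.
move: y y0 e0 h {yE} => y y0 e0 h.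
rewrite -(ler_pM2r y0) -(ler_pM2r (ltr0n R 2)).
have -> : expR y * (y^-1 - 2^-1) * y * 2 = expR y * (2 - y) by field; rewrite gt_eqF.
by apply: (le_trans h); rewrite le_eqVlt; apply/orP; left; apply/eqP; field; rewrite gt_eqF.
Qed.

(** For z = ln ((n + 1) / n), sinh z = (2n + 1) / (2n (n + 1)), so z <= sinh z gives (n + 1/2) z <=
    1 + 1 / (4n (n + 1)), whose excess over 1 telescopes. *)
Lemma ln_ratio_le (n : nat) : (0 < n)%N ->
  (n%:R + 2^-1) * (ln n.+1%:R - ln n%:R) <= 1 + 4^-1 * (n%:R^-1 - n.+1%:R^-1) :> R.
Proof.
move=> n0; have n0' : 0 < n%:R :> R by rewrite ltr0n.
have n1 : 0 < n%:R + 1 :> R by lra.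
rewrite -ln_div ?posrE ?ltr0n // -[n.+1%:R]natr1.
set z := ln _; have z0 : 0 <= z by rewrite ln_ge0 // ler_pdivlMr //; lra.
have := expR_sinh z0; rewrite lnK ?posrE ?divr_gt0 // => h.
rewrite -subr_ge0.
have -> : 1 + 4^-1 * (n%:R^-1 - (n%:R + 1)^-1) - (n%:R + 2^-1) * z =
  (n%:R + 2^-1) * n%:R / (2 * (n%:R + 1)) *
  (((n%:R + 1) / n%:R) ^+ 2 - 1 - 2 * z * ((n%:R + 1) / n%:R)).
  by field; rewrite !gt_eqF.
by rewrite mulr_ge0 ?subr_ge0 // divr_ge0 ?mulr_ge0 //; lra.
Qed.

(* The logarithm of [n! / (sqrt n * (n / e) ^ n)]. *)
Definition ln_stirling (n : nat) : R := ln n`!%:R - (n%:R + 2^-1) * ln n%:R + n%:R.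

Lemma ln_factS n : ln n.+1`!%:R = ln n.+1%:R + ln n`!%:R :> R.
Proof. by rewrite factS natrM lnM ?posrE ?ltr0n ?fact_gt0. Qed.

Lemma ln_stirling_diff n : ln_stirling n - ln_stirling n.+1 =
  (n%:R + 2^-1) * (ln n.+1%:R - ln n%:R) - 1.
Proof.
by rewrite /ln_stirling ln_factS; move: (ln n.+1%:R) => a; rewrite -[n.+1%:R]natr1; ring.
Qed.

Lemma ln_stirling_le m n : (0 < m <= n)%N -> ln_stirling n <= ln_stirling m.
Proof.
move=> /andP[m0]; elim: n => [|n IH]; first by rewrite leqNgt m0.
rewrite leq_eqVlt => /predU1P[->//|]; rewrite ltnS => mn.
apply: le_trans (IH mn); rewrite -subr_ge0 ln_stirling_diff subr_ge0.
by rewrite ln_ratio_ge // (leq_trans m0).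
Qed.

Lemma ln_stirling_corrected_le m n : (0 < m <= n)%N ->
  ln_stirling m - (4 * m%:R)^-1 <= ln_stirling n - (4 * n%:R)^-1.
Proof.
move=> /andP[m0]; elim: n => [|n IH]; first by rewrite leqNgt m0.
rewrite leq_eqVlt => /predU1P[->//|]; rewrite ltnS => mn.
apply: (le_trans (IH mn)); have := ln_ratio_le (leq_trans m0 mn).
rewrite -lerBlDl -ln_stirling_diff !invfM.
by set a := n%:R^-1; set b := n.+1%:R^-1; lra.
Qed.

(** The terms in n ln n cancel and leave ln c + (ln n - ln 2) / 2 with c = C(2n, n) / 4^n, to which
    [central_binomial_le] applies. *)
Lemma ln_stirling_double n : (0 < n)%N ->
  ln_stirling n.*2 - 2 * ln_stirling n <= - (2^-1 * ln (2 * pi)).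
Proof.
move=> n0; have n0' : 0 < n%:R :> R by rewrite ltr0n.
have pi0 := pi_gt0 R.
have f0 k : 0 < k`!%:R :> R by rewrite ltr0n fact_gt0.
have e4 : 0 < 4 ^+ n :> R by rewrite exprn_gt0.
have := central_binomial_le R n0.
rewrite -ler_ln ?posrE ?ltr01 //; last first.
  by rewrite !mulr_gt0 ?exprn_gt0 ?invr_gt0 ?mulr_gt0 ?exprn_gt0.
rewrite ln1 lnM ?posrE ?mulr_gt0 ?exprn_gt0 ?divr_gt0 ?mulr_gt0 ?exprn_gt0 //.
rewrite lnM ?posrE // lnXn ?divr_gt0 ?mulr_gt0 ?exprn_gt0 //.
rewrite ln_div ?posrE ?mulr_gt0 ?exprn_gt0 //.
rewrite [ln (4 ^+ n * _)]lnM ?posrE ?exprn_gt0 // !lnXn //.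
have -> : 4 = 2 * 2 :> R by lra.
rewrite [ln (2 * 2)]lnM ?posrE ?ltr0n // -(mulr_natl (ln 2 + ln 2)) => h.
rewrite /ln_stirling -muln2 natrM !lnM ?posrE ?ltr0n //.
rewrite muln2; lra.
Qed.

(** Write s for [ln_stirling]. For m >= n, s_n >= s_m; further s_m >= (1/2) ln (2 pi) + s_(2m) - s_m
    by [ln_stirling_double], and s_(2m) - s_m >= - 1 / (4m) by the corrected monotonicity. Then m
    tends to infinity. *)
Lemma ln_stirling_ge n : (0 < n)%N -> 2^-1 * ln (2 * pi) <= ln_stirling n.
Proof.
move=> n0; have lim m : (n <= m)%N -> 2^-1 * ln (2 * pi) - (4 * m%:R)^-1 <= ln_stirling n.
  move=> nm; have m0 : (0 < m)%N by apply: leq_trans nm.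
  have m0' : 0 < m%:R :> R by rewrite ltr0n.
  have := ln_stirling_double m0.
  have mm : (0 < m <= m.*2)%N by rewrite m0 -addnn leq_addr.
  have nm' : (0 < n <= m)%N by rewrite n0.
  have := ln_stirling_corrected_le mm; have := ln_stirling_le nm'.
  have : 0 <= (4 * (m.*2)%:R)^-1 :> R by rewrite invr_ge0 mulr_ge0.
  by move: (4 * m%:R)^-1 => c; lra.
apply/ler_addgt0Pl => e e0.
pose m := maxn n (Num.truncn e^-1).+1.
have := lim m (leq_maxl _ _).
suff : (4 * m%:R)^-1 <= e by lra.
have m0 : 0 < m%:R :> R by rewrite ltr0n (leq_trans n0) // leq_maxl.
rewrite -[leRHS]invrK lef_pV2 ?posrE ?invr_gt0 ?mulr_gt0 //.
have : e^-1 <= m%:R.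
  apply: (le_trans (ltW (truncnS_gt _))); rewrite ler_nat leq_maxr //.
lra.
Qed.

(** With s = [ln_stirling], C(n, k) is estimated by s_n <= s_k and s_(n-k) >= (1/2) ln (2 pi). The
    remaining exponential factor is at most 1 by Gibbs' inequality, whose two terms are bounded by n
    q - k and n (1 - q) - (n - k), of sum 0. *)
Lemma binomial_prob_le (q : R) n k : 0 < q < 1 -> (0 < k < n)%N ->
  'C(n, k)%:R * q ^+ k * (1 - q) ^+ (n - k) <=
  Num.sqrt (n%:R / (2 * pi * (k%:R * (n - k)%:R))).
Proof.
move=> /andP[q0 q1] /andP[k0 kn].
have pi0 := pi_gt0 R.
have q1' : 0 < 1 - q by lra.
have n0 : (0 < n)%N by apply: leq_trans kn.
have nk0 : (0 < n - k)%N by rewrite subn_gt0.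
have [n0' k0' nk0'] : [/\ 0 < n%:R :> R, 0 < k%:R :> R & 0 < (n - k)%:R :> R].
  by rewrite !ltr0n.
have nE : n%:R = k%:R + (n - k)%:R :> R by rewrite -natrD subnKC // ltnW.
have C0 : 0 < 'C(n, k)%:R :> R by rewrite ltr0n bin_gt0 ltnW.
have f0 j : 0 < j`!%:R :> R by rewrite ltr0n fact_gt0.
set r := n%:R / _.
have r0 : 0 < r by rewrite divr_gt0 ?mulr_gt0.
have lnr : ln r = ln n%:R - ln (2 * pi) - ln k%:R - ln (n - k)%:R.
  rewrite /r ln_div ?posrE ?mulr_gt0 // [ln (2 * pi * _)]lnM ?posrE ?mulr_gt0 //.
  by rewrite [ln (k%:R * _)]lnM ?posrE //; ring.
clearbody r.
rewrite -[leRHS]powR12_sqrt ?(ltW r0) // -ler_ln ?posrE ?powR_gt0 ?mulr_gt0 ?exprn_gt0 //.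
rewrite ln_powR lnM ?posrE ?mulr_gt0 ?exprn_gt0 // lnM ?posrE ?exprn_gt0 // !lnXn //.
have lnC : ln 'C(n, k)%:R = ln n`!%:R - ln k`!%:R - ln (n - k)`!%:R :> R.
  have := bin_fact (ltnW kn) => /(congr1 (fun j => ln (j%:R : R))).
  by rewrite !natrM !lnM ?posrE ?mulr_gt0 //; lra.
have h1 : ln_stirling n <= ln_stirling k by apply: ln_stirling_le; rewrite k0 ltnW.
have h2 := ln_stirling_ge nk0.
have gibbs (x y : R) : 0 < x -> 0 < y -> y * (ln x - ln y) <= x - y.
  move=> x0 y0; rewrite -ln_div ?posrE //.
  have : ln (1 + (x / y - 1)) <= x / y - 1.
    by apply: le_ln1Dx; have := divr_gt0 x0 y0; lra.
  rewrite addrC subrK -(ler_pM2l y0) => /le_trans; apply.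
  by rewrite mulrBr mulrCA divff ?gt_eqF // !mulr1.
have := gibbs (n%:R * q) k%:R (mulr_gt0 n0' q0) k0'.
have := gibbs (n%:R * (1 - q)) (n - k)%:R (mulr_gt0 n0' q1') nk0'.
rewrite lnC lnr [ln (n%:R * q)]lnM ?posrE // [ln (n%:R * (1 - q))]lnM ?posrE //.
rewrite -(mulr_natl (ln q)) -(mulr_natl (ln (1 - q))).
move: h1 h2; rewrite /ln_stirling nE.
move: (ln n`!%:R) (ln k`!%:R) (ln (n - k)`!%:R) (ln (2 * pi)) (ln q) (ln (1 - q)) => A B C D E F.
move: (ln (k%:R + (n - k)%:R)) (ln k%:R) (ln (n - k)%:R) => G H I.
move: (k%:R) ((n-k)%:R) => K L h1 h2 h3 h4; lra.
Qed.
End Stirling.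

(** * Powers of binomial weights *)

Section BinomialWeights.
Variables (R : realType) (q : R).

Definition binomial_weight (n k : nat) : R := 'C(n, k)%:R * q ^+ k * (1 - q) ^+ (n - k).

(** Conditioning on one trial; total mass and variance follow by induction on n. *)
Lemma binomial_weight_expect_rec n (f : nat -> R) :
  \sum_(k < n.+2) binomial_weight n.+1 k * f k =
  q * \sum_(k < n.+1) binomial_weight n k * f k.+1 +
  (1 - q) * \sum_(k < n.+1) binomial_weight n k * f k.
Proof.
rewrite !mulr_sumr [LHS]big_ord_recl [X in _ = _ + X]big_ord_recl [RHS]addrCA /=.
congr (_ + _).
  by rewrite /binomial_weight !bin0 !subn0 exprS; ring.
rewrite [X in _ = _ + X](_ : _ =
    \sum_(i < n.+1) (1 - q) * (binomial_weight n i.+1 * f i.+1)); last first.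
  by rewrite big_ord_recr /= /binomial_weight bin_small // mulr0n !mul0r mulr0 addr0.
rewrite -big_split /=; apply: eq_bigr => k _; rewrite /bump /= add1n.
rewrite /binomial_weight binS natrD subSS exprS.
have [kn|kn] := ltnP k n; last first.
  by rewrite bin_small ?ltnS // mulr0n; ring.
by rewrite -[(n - k)%N](subnSK kn) exprS; ring.
Qed.

Lemma sum_binomial_weight n : \sum_(k < n.+1) binomial_weight n k = 1.
Proof.
elim: n => [|n IH].
  by rewrite big_ord1 /binomial_weight bin0 subn0 !expr0 !mulr1.
have := binomial_weight_expect_rec n (fun=> 1).
have e m : \sum_(k < m.+1) binomial_weight m k * 1 = \sum_(k < m.+1) binomial_weight m k.
  by apply: eq_bigr => k _; rewrite mulr1.
by rewrite /= !e IH => ->; ring.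
Qed.

(** The centre c is arbitrary because a success shifts it to c - 1 in the induction. *)
Lemma binomial_weight_variance n c :
  \sum_(k < n.+1) binomial_weight n k * (k%:R - c) ^+ 2 =
  n%:R * q * (1 - q) + (n%:R * q - c) ^+ 2.
Proof.
elim: n c => [|n IH] c.
  by rewrite big_ord1 /binomial_weight bin0 subn0 !expr0 mulr0n; ring.
rewrite (binomial_weight_expect_rec n (fun k => (k%:R - c) ^+ 2)) IH.
rewrite (eq_bigr (fun k : 'I_n.+1 => binomial_weight n k * (k%:R - (c - 1)) ^+ 2)).
  by rewrite IH -[n.+1%:R]natr1; ring.
by move=> k _; rewrite -[k.+1%:R]natr1; congr (_ * _ ^+ 2); ring.
Qed.

Hypothesis q01 : 0 < q < 1.
Let q0 : 0 < q. Proof. by case/andP: q01. Qed.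
Let q1 : 0 < 1 - q. Proof. by rewrite subr_gt0; case/andP: q01. Qed.

Lemma binomial_weight_ge0 n k : 0 <= binomial_weight n k.
Proof. by rewrite /binomial_weight !mulr_ge0 ?exprn_ge0 // ltW. Qed.

Lemma binomial_weight_gt0 n k : (k <= n)%N -> 0 < binomial_weight n k.
Proof. by move=> kn; rewrite /binomial_weight !mulr_gt0 ?exprn_gt0 // ltr0n bin_gt0. Qed.

Lemma binomial_weightS n k : (k < n)%N ->
  binomial_weight n k.+1 * (k.+1%:R * (1 - q)) = binomial_weight n k * ((n - k)%:R * q).
Proof.
move=> kn; rewrite /binomial_weight -[(n - k)%N](subnSK kn) !exprS.
have := congr1 (fun j => j%:R : R) (mul_bin_left n k).
rewrite !natrM -[(n - k)%N](subnSK kn) => h.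
transitivity (k.+1%:R * 'C(n, k.+1)%:R * (q * q ^+ k * (1 - q) ^+ (n - k.+1) * (1 - q))).
  by ring.
by rewrite h; ring.
Qed.

(** Comparing a maximal weight with its neighbours through [binomial_weightS] places the mode
    between (n + 1) q - 1 and (n + 1) q; at k = n or k = 0, where a neighbour is missing, the
    inequality is immediate. *)
Lemma binomial_weight_mode n : exists k, [/\ (k <= n)%N,
  forall j, (j <= n)%N -> binomial_weight n j <= binomial_weight n k,
  n%:R * q - (1 - q) <= k%:R & n%:R * (1 - q) - q <= (n - k)%:R].
Proof.
have [k _ kmax] := Order.TotalTheory.arg_maxP (i0 := @ord0 n) (P := xpredT)
  (fun k : 'I_n.+1 => binomial_weight n k) isT.
have kn : (k <= n)%N by rewrite -ltnS.
have {}kmax j : (j <= n)%N -> binomial_weight n j <= binomial_weight n k.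
  by move=> jn; have := kmax (Ordinal (jn : (j < n.+1)%N)) isT.
exists k; split=> //.
  have [kn'|] := ltnP k n; last first.
    move=> nk; have -> : nat_of_ord k = n by apply/eqP; rewrite eqn_leq kn.
    have : n%:R * q <= n%:R by rewrite ler_piMr // ltW // -subr_gt0.
    by have := q1; lra.
  have k1 : 0 < k.+1%:R * (1 - q) by rewrite mulr_gt0 ?ltr0n.
  have := kmax _ kn'; rewrite -(ler_pM2r k1) binomial_weightS //.
  rewrite ler_pM2l ?binomial_weight_gt0 // -natr1 natrB //.
  by lra.
case: (nat_of_ord k) kn kmax => [|k'] kn kmax.
  rewrite subn0; have : n%:R * (1 - q) <= n%:R by rewrite ler_piMr // gerBl ltW.
  by have := q0; lra.
have k1 : 0 < (n - k')%:R * q by rewrite mulr_gt0 // ltr0n subn_gt0.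
have := kmax _ (ltnW kn); rewrite -(ler_pM2r k1) -binomial_weightS //.
rewrite ler_pM2l ?binomial_weight_gt0 // !natrB ?(ltnW kn) // -[k'.+1%:R]natr1.
lra.
Qed.

(** The two conditions on l turn the location of the mode m into m >= (1 - l) n q and n - m >= (1 -
    l) n (1 - q), which enter [binomial_prob_le]. *)
Lemma binomial_weight_le_mode n (l : R) k : 0 < l < 1 ->
  1 - q <= l * (n%:R * q) -> q <= l * (n%:R * (1 - q)) -> (k <= n)%N ->
  binomial_weight n k <=
    Num.sqrt (2 * pi * n%:R * (q * (1 - q)) * (1 - l) ^+ 2)^-1.
Proof.
move=> /andP[l0 l1] lq1 lq2 kn.
have [m [mn mmax m1 m2]] := binomial_weight_mode n.
have l1' : 0 < 1 - l by rewrite subr_gt0.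
have pi0 := pi_gt0 R.
have n0 : 0 < n%:R :> R.
  rewrite ltr0n lt0n; apply/eqP => n0; move: lq2; rewrite n0 mul0r mulr0.
  by rewrite leNgt q0.
have {}m1 : (1 - l) * (n%:R * q) <= m%:R by lra.
have {}m2 : (1 - l) * (n%:R * (1 - q)) <= (n - m)%:R by lra.
have nq : 0 < (1 - l) * (n%:R * q) by rewrite !mulr_gt0.
have nq' : 0 < (1 - l) * (n%:R * (1 - q)) by rewrite !mulr_gt0.
have m0 : 0 < m%:R :> R by apply: lt_le_trans m1.
have nm0 : 0 < (n - m)%:R :> R by apply: lt_le_trans m2.
apply: (le_trans (mmax k kn)).
have mm : (0 < m < n)%N by rewrite -[(m < n)%N]subn_gt0 -!(ltr0n R) m0.
apply: (le_trans (binomial_prob_le q01 mm)); apply: ler_wsqrtr.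
rewrite -[leLHS]invrK lef_pV2 ?posrE ?invr_gt0 ?divr_gt0 ?mulr_gt0 ?exprn_gt0 //.
rewrite invf_div ler_pdivlMr //.
have -> : 2 * pi * n%:R * (q * (1 - q)) * (1 - l) ^+ 2 * n%:R =
  2 * pi * (((1 - l) * (n%:R * q)) * ((1 - l) * (n%:R * (1 - q)))) by ring.
by rewrite ler_pM2l ?mulr_gt0 // ler_pM // ltW.
Qed.

Lemma sum_binomial_weightX_le n d (c : R) :
  (forall k, (k <= n)%N -> binomial_weight n k <= c) ->
  \sum_(k < n.+1) binomial_weight n k ^+ d.+1 <= c ^+ d.
Proof.
move=> wc; rewrite -[leRHS]mulr1 -(sum_binomial_weight n) mulr_sumr.
apply: ler_sum => k _; rewrite exprSr ler_wpM2r ?binomial_weight_ge0 //.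
have kn : (k <= n)%N by rewrite -ltnS.
have w0 := binomial_weight_ge0 n k.
by apply: lerXn2r; rewrite ?nnegrE ?wc //; apply: le_trans (wc k kn).
Qed.

Lemma count_nat_interval_le (u v : R) n : u <= v + 1 ->
  \sum_(k < n) (if u <= k%:R <= v then 1 else 0) <= v + 1 - u.
Proof.
move=> uv.
(* Strengthened for the induction: among k < n the count is at most min(n, v + 1) - u, or 0 if that
   is negative. *)
suff : \sum_(k < n) (if u <= k%:R <= v then 1 else 0) <=
    Num.max 0 (Num.min n%:R (v + 1) - u).
  move=> /le_trans; apply; rewrite ge_max subr_ge0 uv /= lerD2r ge_min lexx orbT //.
elim: n => [|n IH]; first by rewrite big_ord0 le_max lexx.
rewrite big_ord_recr /=; case: ifP => [/andP[un nv]|_]; last first.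
  rewrite addr0 (le_trans IH) // ge_max !le_max lexx /= lerD2r le_min !ge_min lexx orbT andbT.
  by rewrite ler_nat leqnSn !orbT.
rewrite -natr1 [Num.min (n%:R + 1) _]min_l ?lerD2r // le_max; apply/orP; right.
move: IH; rewrite min_l; last by lra.
by rewrite max_r; lra.
Qed.

(** The left side is the tangent at y of x^(d+1); the gap for d + 1 is x times the gap for d plus (d
    + 1) y^d (x - y)^2. *)
Lemma exprn_tangent_ge (x y : R) d : 0 <= x -> 0 <= y ->
  d.+1%:R * y ^+ d * x - d%:R * y ^+ d.+1 <= x ^+ d.+1.
Proof.
move=> x0 y0; elim: d => [|d IH]; first by rewrite expr0 expr1 mulr1 mul1r mul0r subr0.
have := ler_wpM2r x0 IH; rewrite -exprSr; apply: le_trans.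
rewrite -subr_ge0 -[d.+2%:R]natr1 -[d.+1%:R]natr1 !exprS.
have -> : ((d%:R + 1) * y ^+ d * x - d%:R * (y * y ^+ d)) * x -
   ((d%:R + 1 + 1) * (y * y ^+ d) * x - (d%:R + 1) * (y * (y * y ^+ d))) =
   (d%:R + 1) * y ^+ d * (x - y) ^+ 2 by ring.
by rewrite mulr_ge0 ?sqr_ge0 // mulr_ge0 ?exprn_ge0 // addr_ge0.
Qed.

(* Chebyshev gives mass at least 3/4 to the window |k - n q| <= sqrt n, which
   contains at most 3 sqrt n integers, and convexity of x^d does the rest. *)
Lemma sum_binomial_weightX_ge n d : (0 < n)%N ->
  3 / 4 * (4 * Num.sqrt n%:R)^-1 ^+ d <= \sum_(k < n.+1) binomial_weight n k ^+ d.+1.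
Proof.
(* The tangent is taken at y = (3/4) / (3 s), the mean weight when mass 3/4 is spread over 3 s
   integers. *)
move=> n0; set s := Num.sqrt n%:R; set y := (4 * s)^-1.
have n1 : 1 <= n%:R :> R by rewrite ler1n.
have n0' : 0 < n%:R :> R by rewrite ltr0n.
have s0 : 0 < s by rewrite sqrtr_gt0.
have s2 : s ^+ 2 = n%:R by rewrite sqr_sqrtr // ltW.
have s1 : 1 <= s by rewrite -sqrtr1 ler_wsqrtr.
have y0 : 0 < y by rewrite invr_gt0 mulr_gt0.
set W := fun k : nat => n%:R * q - s <= k%:R <= n%:R * q + s.
(* Off the window the factor 1 - (k - n q)^2 / n is nonpositive, and its expectation is 1 - q (1 -
   q) >= 3/4. *)
have cheb : 3 / 4 <= \sum_(k < n.+1) (if W k then binomial_weight n k else 0).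
  have : \sum_(k < n.+1)
        (binomial_weight n k - binomial_weight n k * ((k%:R - n%:R * q) ^+ 2 / n%:R))
      <= \sum_(k < n.+1) (if W k then binomial_weight n k else 0).
    apply: ler_sum => k _; have wk := binomial_weight_ge0 n k.
    case: ifPn => [_|Wk].
      by rewrite gerBl mulr_ge0 // divr_ge0 ?sqr_ge0.
    rewrite -{1}[binomial_weight n k]mulr1 -mulrBr mulr_ge0_le0 // subr_le0.
    rewrite ler_pdivlMr // mul1r -s2 -[X in X <= _]real_normK ?num_real //.
    rewrite -[X in _ <= X]real_normK ?num_real // lerXn2r ?nnegrE //.
    rewrite (ger0_norm (ltW s0)) leNgt; apply: contra Wk; rewrite ltr_norml s2 => /andP[a b].
    by apply/andP; split; lra.
  apply: le_trans; rewrite sumrB sum_binomial_weight.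
  under eq_bigr do rewrite mulrA; rewrite -mulr_suml binomial_weight_variance subrr expr0n /= addr0.
  have -> : n%:R * q * (1 - q) / n%:R = q * (1 - q) by field; rewrite gt_eqF.
  by have := sqr_ge0 (q - 2^-1); rewrite expr2; lra.
have cnt : \sum_(k < n.+1) (if W k then 1 else 0) <= 3 * s.
  have := @count_nat_interval_le (n%:R * q - s) (n%:R * q + s) n.+1.
  by rewrite -/W => h; apply: (le_trans (h _)); lra.
have : \sum_(k < n.+1)
      (if W k then d.+1%:R * y ^+ d * binomial_weight n k - d%:R * y ^+ d.+1 else 0)
    <= \sum_(k < n.+1) binomial_weight n k ^+ d.+1.
  apply: ler_sum => k _; case: ifP => _; last by rewrite exprn_ge0 ?binomial_weight_ge0.
  by rewrite exprn_tangent_ge ?binomial_weight_ge0 // ltW.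
apply: le_trans.
rewrite [leRHS](_ : _ =
   d.+1%:R * y ^+ d * (\sum_(k < n.+1) (if W k then binomial_weight n k else 0))
   - d%:R * y ^+ d.+1 * (\sum_(k < n.+1) (if W k then 1 else 0))); last first.
  rewrite !mulr_sumr -sumrB; apply: eq_bigr => k _; case: ifP => _; ring.
have yd : 0 <= y ^+ d by rewrite exprn_ge0 // ltW.
have h1 := ler_wpM2l (mulr_ge0 (ler0n R d.+1) yd) cheb.
have h2 := ler_wpM2l (mulr_ge0 (ler0n R d) (exprn_ge0 d.+1 (ltW y0))) cnt.
have ys : y * s = 4^-1 by rewrite /y; field; rewrite gt_eqF.
have e : d%:R * y ^+ d.+1 * (3 * s) = d%:R * y ^+ d * (3 / 4).
  transitivity (d%:R * y ^+ d * 3 * (y * s)); first by rewrite exprS; ring.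
  by rewrite ys; ring.
move: h1 h2; rewrite e -[d.+1%:R]natr1; lra.
Qed.

End BinomialWeights.

(** * Bounds on the coefficients r_n *)

Section PowerBounds.
Variable R : realType.
Implicit Types a l x : R.

Lemma npow_half n m : (0 < n)%N ->
  npow n (- (m%:R / 2) : R) = (Num.sqrt n%:R)^-1 ^+ m.
Proof.
move=> n0; have n0' : 0 <= n%:R :> R by rewrite ler0n.
rewrite /npow powRN exprVn; congr (_^-1).
by rewrite -powR12_sqrt // -powR_mulrn ?powR_ge0 // -powRrM [m%:R / 2]mulrC.
Qed.

(** Starts from e^(1/4) >= 5/4, doubles the argument twice by 1 + 2 z e^z <= e^(2z), then squares
    21/8. The precision is dictated by the next lemma, which uses (27/4)^2 >= 136/3. *)
Lemma expR2_ge : 27 / 4 <= expR 2 :> R.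
Proof.
have dbl (z : R) : 0 <= z -> 1 + 2 * z * expR z <= expR (2 * z).
  by move=> z0; rewrite expRM_natl addrC -lerBrDr expR_sinh.
have e4 : 5 / 4 <= expR 4^-1 :> R by apply: le_trans (expR_ge1Dx _); lra.
have e2 : 13 / 8 <= expR (2 * 4^-1) :> R.
  by apply: le_trans (dbl _ _); [move: (expR _) e4 => x; lra|].
have e1 : 21 / 8 <= expR (2 * (2 * 4^-1)) :> R.
  by apply: le_trans (dbl _ _); [move: (expR _) e2 => x; lra|lra].
have -> : 2 = 2%:R * (2 * (2 * 4^-1)) :> R by lra.
rewrite expRM_natl expr2; apply: (@le_trans _ _ (21 / 8 * (21 / 8))); first lra.
by rewrite ler_pM.
Qed.

(** Amounts to e^4 >= 16 sqrt (2 pi). From pi < 4, sqrt (2 pi) is below sqrt 8, of which 17/6 is a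
    rational bound, and 16 times 17/6 is 136/3. The value 1/4 is the base of the powers in the
    Chebyshev bound. *)
Lemma sqrt2pi_div_expR4_le : Num.sqrt (2 * pi) / expR 2 * (4 * expR (- 2)) <= 4^-1 :> R.
Proof.
have e0 := expR_gt0 (2 : R); have e2 := expR2_ge.
have s3 : Num.sqrt (2 * pi) <= 17 / 6 :> R.
  rewrite -[leRHS]ger0_norm // -sqrtr_sqr ler_wsqrtr // expr2.
  by have := pihalf_lt2 R; move: pi => P; lra.
have e3 : 136 / 3 <= expR 2 * expR 2 :> R.
  by apply: (@le_trans _ _ (27 / 4 * (27 / 4))); [lra|rewrite ler_pM].
rewrite expRN.
have -> : Num.sqrt (2 * pi) / expR 2 * (4 * (expR 2)^-1) =
    Num.sqrt (2 * pi) * 4 / (expR 2 * expR 2) :> R.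
  by field; rewrite gt_eqF.
rewrite ler_pdivrMr ?mulr_gt0 //.
by move: (Num.sqrt _) (expR 2 * expR 2) s3 e3 => x y; lra.
Qed.

(* [beta * exp (- beta / 2)] is nonincreasing for [beta >= 4]. *)
Lemma max_expR_le x y beta : 4 <= beta -> x <= beta -> beta <= y ->
  Num.max 4 x * expR (- (1 / 2) * y) <= 4 * expR (- 2).
Proof.
move=> b4 xb yb.
apply: (@le_trans _ _ (4 * expR (beta / 4 - 1) * expR (- (1 / 2) * y))).
  rewrite ler_wpM2r ?expR_ge0 // (@le_trans _ _ beta) ?ge_max ?b4 //.
  have := expR_ge1Dx (beta / 4 - 1); lra.
rewrite -mulrA -expRD ler_pM2l // ler_expR; lra.
Qed.

(** (a + 1)^2 / a is the beta at which [max_expR_le] is used for both C_1 and C_2: it lies above the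
    second entry of the maximum and below the factor of -1/2 in the exponent. *)
Lemma amgm_ratio_ge4 a : 0 < a -> 4 <= (a + 1) ^+ 2 / a.
Proof.
move=> a0; rewrite ler_pdivlMr // -subr_ge0.
by rewrite (_ : _ - _ = (a - 1) ^+ 2) ?sqr_ge0 //; ring.
Qed.

Lemma C1c_le a l : 0 < a -> 0 < l < 1 -> C1c a l <= 4 * expR (- 2).
Proof.
move=> a0 /andP[l0 l1]; rewrite /C1c -mulrA.
have la : 0 < l * a by rewrite mulr_gt0.
have l1' : 0 < 1 - l by lra.
have s0 : 0 < (a + 1) ^+ 2 by rewrite exprn_gt0 //; lra.
apply: (max_expR_le (amgm_ratio_ge4 a0)).
  rewrite ler_wpM2l ?(ltW s0) // lef_pV2 ?posrE ?mulr_gt0 //; last lra.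
  by rewrite ler_peMr ?(ltW a0) //; lra.
rewrite mulrC ler_pM ?invr_ge0 ?(ltW a0) ?(ltW s0) //.
  rewrite invfM mulrA ler_peMl ?invr_ge0 ?(ltW a0) // ler_pdivlMr //; lra.
by rewrite lerDl divr_ge0 //; lra.
Qed.

Lemma C2c_le a l : 0 < a -> 0 < l < 1 -> C2c a l <= 4 * expR (- 2).
Proof.
move=> a0 /andP[l0 l1]; rewrite /C2c -mulrA.
have la : 0 < l * a by rewrite mulr_gt0.
have l1' : 0 < 1 - l by lra.
have s0 : 0 < (a + 1) ^+ 2 by rewrite exprn_gt0 //; lra.
have a2 : 0 < a ^+ 2 by rewrite exprn_gt0.
apply: (max_expR_le (amgm_ratio_ge4 a0)).
  rewrite ler_wpM2l ?(ltW s0) // lef_pV2 ?posrE //; lra.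
rewrite mulrC ler_pM ?invr_ge0 ?(ltW a0) ?(ltW s0) //.
  rewrite ler_pdivlMr ?mulr_gt0 //.
  by rewrite [leLHS](_ : _ = (1 - l) * a); [lra|field; rewrite gt_eqF].
by rewrite lerDl divr_ge0 ?mulr_ge0 ?(ltW a2) //; lra.
Qed.

Lemma C1c_gt0 a l : 0 < C1c a l.
Proof. by rewrite mulr_gt0 ?expR_gt0 // lt_max ltr0n. Qed.

Lemma C2c_gt0 a l : 0 < C2c a l.
Proof. by rewrite mulr_gt0 ?expR_gt0 // lt_max ltr0n. Qed.

Lemma Kc_gt0 a d l : 0 < a -> 0 < l < 1 -> 0 < Kc a d l.
Proof.
move=> a0 /andP[l0 l1].
have c0 : 0 < ((1 - l) * a + 1) / (a + 1).
  by rewrite divr_gt0 ?addr_gt0 ?mulr_gt0 ?subr_gt0.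
have [h1 h2] := (exprn_gt0 d (C1c_gt0 a l), exprn_gt0 d (C2c_gt0 a l)).
by rewrite addr_gt0 // mulr_gt0.
Qed.

(** The weight ((1 - l) a + 1) / (a + 1) in K is at most 1, so K <= 2 (4 e^(-2))^d. The result stays
    below the factor 3 / 4^d of [rr_ge]. *)
Lemma Kc_le a d l : 0 < a -> 0 < l < 1 ->
  (Num.sqrt (2 * pi) / expR 2) ^+ d * Kc a d l <= 2 * 4^-1 ^+ d.
Proof.
move=> a0 l01; have /andP[l0 l1] := l01.
have la : 0 < l * a by rewrite mulr_gt0.
have la1 : l * a < a by rewrite gtr_pMl.
have c0 : 0 <= Num.sqrt (2 * pi) / expR 2 :> R.
  by rewrite divr_ge0 ?sqrtr_ge0 ?expR_ge0.
have kle : Kc a d l <= 2 * (4 * expR (- 2)) ^+ d.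
  have e0 : 0 <= 4 * expR (- 2) :> R by rewrite mulr_ge0 ?expR_ge0.
  have h1 : C1c a l ^+ d <= (4 * expR (- 2)) ^+ d.
    by apply: lerXn2r; rewrite ?nnegrE ?C1c_le // ltW ?C1c_gt0.
  have h2 : C2c a l ^+ d <= (4 * expR (- 2)) ^+ d.
    by apply: lerXn2r; rewrite ?nnegrE ?C2c_le // ltW ?C2c_gt0.
  rewrite mulr_natl mulr2n lerD // -[leRHS]mul1r ler_pM //.
  - by rewrite divr_ge0 //; lra.
  - by rewrite exprn_ge0 // ltW ?C1c_gt0.
  - by rewrite ler_pdivrMr; lra.
apply: le_trans (ler_wpM2l (exprn_ge0 d c0) kle) _.
rewrite mulrCA -exprMn ler_pM2l //.
by apply: lerXn2r; rewrite ?nnegrE ?sqrt2pi_div_expR4_le // mulr_ge0 // mulr_ge0 ?expR_ge0.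
Qed.

End PowerBounds.

(** * Transfer from binomial weights to r_n *)

Section RencontreBounds.
Variables (R : realType) (d : nat) (p : 'I_d -> R).
Hypothesis d0 : (0 < d)%N.
Hypothesis p01 : forall j, 0 < p j < 1.

Lemma qq_gt0 j : 0 < qq p j.
Proof. by rewrite subr_gt0; case/andP: (p01 j). Qed.

Lemma QQ_gt0 : 0 < QQ p.
Proof. by apply: prodr_gt0 => j _; exact: qq_gt0. Qed.

Lemma PP_gt0 : 0 < PP p.
Proof. by apply: prodr_gt0 => j _; rewrite divr_gt0 ?qq_gt0 //; case/andP: (p01 j). Qed.

Lemma alphaP_gt0 : 0 < alphaP p.
Proof. by rewrite powR_gt0 ?PP_gt0. Qed.

Lemma powR_invnX (x : R) : 0 <= x -> (x `^ d%:R^-1) ^+ d = x.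
Proof.
by move=> x0; rewrite -powR_mulrn ?powR_ge0 // -powRrM mulVf ?powRr1 // pnatr_eq0 -lt0n.
Qed.

Lemma alphaPX : alphaP p ^+ d = PP p.
Proof. by rewrite powR_invnX // ltW ?PP_gt0. Qed.

Lemma TT_gt0 : 0 < TT p.
Proof. by rewrite mulr_gt0 ?QQ_gt0 // exprn_gt0 // addr_gt0 ?alphaP_gt0. Qed.

Lemma prod_le_meanX (E : 'I_d -> R) : (forall j, 0 <= E j) ->
  \prod_j E j <= ((\sum_j E j) / d%:R) ^+ d ?= iff [forall i, forall j, E i == E j].
Proof.
move=> E0; have := @leif_AGM R 'I_d predT E (fun j _ => E0 j).
by rewrite card_ord.
Qed.

(** T^(1/d) is the sum of the geometric means of the q_j and of the p_j, each at most the arithmetic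
    mean, and these means add up to 1. Equality of the p_j forces that of the q_j. *)
Lemma TT_le1_if : TT p <= 1 ?= iff [forall i, forall j, p i == p j].
Proof.
set y := QQ p `^ d%:R^-1.
have y0 : 0 <= y by rewrite powR_ge0.
have d0' : 0 < d%:R :> R by rewrite ltr0n.
have yd : y ^+ d = QQ p by rewrite powR_invnX // ltW ?QQ_gt0.
have ya0 : 0 <= y * alphaP p by rewrite mulr_ge0 ?(ltW alphaP_gt0).
have yad : (y * alphaP p) ^+ d = \prod_j p j.
  rewrite exprMn yd alphaPX /QQ /PP -big_split /=; apply: eq_bigr => j _.
  by rewrite mulrC divfK // gt_eqF ?qq_gt0.
have TE : TT p = (y + y * alphaP p) ^+ d.
  by rewrite /TT -yd -exprMn mulrDr mulr1.
have root_le (x : R) (E : 'I_d -> R) : 0 <= x -> (forall j, 0 <= E j) ->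
    x ^+ d = \prod_j E j ->
    x <= (\sum_j E j) / d%:R ?= iff [forall i, forall j, E i == E j].
  move=> x0 E0 xE; have mu0 : 0 <= (\sum_j E j) / d%:R by rewrite divr_ge0 ?sumr_ge0.
  have := prod_le_meanX E0; rewrite -xE => -[h1 h2]; split.
    by rewrite -(ler_pXn2r d0).
  by rewrite -h2 eqrXn2.
have pge0 j : 0 <= p j by apply: ltW; case/andP: (p01 j).
have hq := root_le y (qq p) y0 (fun j => ltW (qq_gt0 j)) yd.
have hp := root_le (y * alphaP p) p ya0 pge0 yad.
have := leifD hq hp; rewrite -mulrDl -big_split /=.
rewrite (eq_bigr (fun=> 1)) => [|j _]; last by rewrite /qq subrK.
rewrite sumr_const card_ord divff ?gt_eqF // => -[h1 h2]; split.
  by rewrite TE exprn_ile1 // addr_ge0.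
rewrite TE -[1 in LHS](expr1n _ d) eqrXn2 ?addr_ge0 // h2.
apply: andb_idl => /forallP h; apply/forallP => i; apply/forallP => j.
by rewrite /qq (eqP (forallP (h i) j)).
Qed.

Let q := alphaP p / (1 + alphaP p).

Lemma alpha_weight01 : 0 < q < 1.
Proof.
have a0 := alphaP_gt0; have a1 : 0 < 1 + alphaP p by rewrite addr_gt0.
by rewrite divr_gt0 //= ltr_pdivrMr // mul1r ltrDr.
Qed.

Lemma rr_binomial_weight n :
  rr p n = TT p ^+ n * \sum_(k < n.+1) binomial_weight q n k ^+ d.
Proof.
have a1 : 1 + alphaP p != 0 by rewrite gt_eqF // addr_gt0 ?alphaP_gt0.
have q1 : 1 - q = (1 + alphaP p)^-1 by rewrite /q; field.
rewrite /rr /TT exprMn -mulrA; congr (_ * _).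
rewrite big_mkord mulr_sumr; apply: eq_bigr => k _.
rewrite exprAC -exprMn -alphaPX exprAC -exprMn; congr (_ ^+ _).
have kn : (k <= n)%N by rewrite -ltnS.
have e : (1 + alphaP p) ^+ n = (1 + alphaP p) ^+ (n - k) * (1 + alphaP p) ^+ k.
  by rewrite -exprD subnK.
rewrite /binomial_weight q1 /q exprMn !exprVn e.
by field; rewrite !expf_neq0.
Qed.

Lemma rr_ge0 n : 0 <= rr p n.
Proof.
rewrite rr_binomial_weight mulr_ge0 ?exprn_ge0 ?(ltW TT_gt0) //.
by apply: sumr_ge0 => k _; rewrite exprn_ge0 // binomial_weight_ge0 // alpha_weight01.
Qed.

(** The two entries of the maximum N are the conditions of the mode bound: n >= a / l means q <= l n
    (1 - q), and n >= 1 / (l a) means 1 - q <= l n q. As q (1 - q) = a / (1 + a)^2, that bound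
    equals M / sqrt (2 pi n). *)
Lemma rr_le n (l : R) : 0 < l < 1 -> (Nc (alphaP p) l <= n)%N ->
  rr p n <= (Mc (alphaP p) l / Num.sqrt (2 * pi)) ^+ d.-1 *
            npow n (- ((d%:R - 1) / 2)) * TT p ^+ n.
Proof.
move=> l01; have /andP[l0 l1] := l01; rewrite /Nc geq_max => /andP[N1 N2].
have a0 := alphaP_gt0; set a := alphaP p in a0 N1 N2 *.
have a1 : 0 < 1 + a by lra.
have l1' : 0 < 1 - l by lra.
have pi0 := pi_gt0 R.
have n0 : (0 < n)%N by apply: leq_trans N1.
have n0' : 0 < n%:R :> R by rewrite ltr0n.
have q1 : 1 - q = (1 + a)^-1 by rewrite /q -/a; field; rewrite gt_eqF.
have {}N1 : a <= l * n%:R.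
  by rewrite mulrC -ler_pdivrMr // (le_trans (ltW (truncnS_gt _))) // ler_nat.
have {}N2 : 1 <= l * a * n%:R.
  by rewrite mulrC -ler_pdivrMr ?mulr_gt0 // (le_trans (ltW (truncnS_gt _))) // ler_nat.
have c1 : 1 - q <= l * (n%:R * q).
  rewrite q1 /q -/a !mulrA ler_pdivlMr // mulVf ?gt_eqF //.
  by rewrite (le_trans N2) // le_eqVlt; apply/orP; left; apply/eqP; ring.
have c2 : q <= l * (n%:R * (1 - q)).
  by rewrite q1 /q -/a !mulrA ler_pM2r ?invr_gt0.
rewrite rr_binomial_weight mulrC ler_pM2r ?exprn_gt0 ?TT_gt0 //.
have -> : (d%:R - 1) / 2 = d.-1%:R / 2 :> R.
  by rewrite -[in d%:R](prednK d0) -natr1 addrK.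
rewrite npow_half // -exprMn -(prednK d0) /=.
apply: sum_binomial_weightX_le => [|k kn]; first exact: alpha_weight01.
apply: (le_trans (binomial_weight_le_mode alpha_weight01 l01 c1 c2 kn)).
have M0 : 0 <= Mc a l / Num.sqrt (2 * pi) * (Num.sqrt n%:R)^-1.
  by rewrite mulr_ge0 ?invr_ge0 ?sqrtr_ge0 ?divr_ge0 ?mulr_ge0 ?sqrtr_ge0 //; lra.
rewrite -[leRHS]ger0_norm // -sqrtr_sqr; apply: ler_wsqrtr.
have [a0' n0'' p0] : [/\ 0 <= a, 0 <= n%:R :> R & 0 <= 2 * pi :> R].
  by split; rewrite ?mulr_ge0 // ltW.
rewrite /Mc !expr_div_n [(Num.sqrt a * _) ^+ 2]exprMn !sqr_sqrtr //.
rewrite q1 /q -/a le_eqVlt; apply/orP; left; apply/eqP; field.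
by rewrite !gt_eqF // ?exprn_gt0 //; lra.
Qed.

Lemma rr_ge n : (0 < n)%N ->
  3 * 4^-1 ^+ d * npow n (- ((d%:R - 1) / 2)) * TT p ^+ n <= rr p n.
Proof.
move=> n0; rewrite rr_binomial_weight [leRHS]mulrC ler_pM2r ?exprn_gt0 ?TT_gt0 //.
have -> : (d%:R - 1) / 2 = d.-1%:R / 2 :> R.
  by rewrite -[in d%:R](prednK d0) -natr1 addrK.
rewrite npow_half // -(prednK d0) /=.
apply: le_trans (sum_binomial_weightX_ge alpha_weight01 _ n0).
by rewrite exprS !mulrA invfM exprMn mulrA.
Qed.

Lemma rr_ge_Kc n (l : R) : 0 < l < 1 -> (0 < n)%N ->
  (Num.sqrt (2 * pi) / expR 2) ^+ d * Kc (alphaP p) d l *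
    npow n (- ((d%:R - 1) / 2)) * TT p ^+ n <= rr p n.
Proof.
move=> l01 n0; apply: le_trans (rr_ge n0).
rewrite ler_pM2r ?exprn_gt0 ?TT_gt0 // ler_wpM2r ?powR_ge0 //.
rewrite (le_trans (Kc_le _ alphaP_gt0 l01)) // ler_pM2r ?exprn_gt0 //; lra.
Qed.

End RencontreBounds.

(** * Series with nonnegative terms *)

Section Sums.
Variable R : realType.
Implicit Types (u v c : R ^nat) (l : R).

Lemma cvg_series_lin u v (a b l l' : R) :
  series u @ \oo --> l -> series v @ \oo --> l' ->
  series (fun n => a * u n + b * v n) @ \oo --> a * l + b * l'.
Proof.
move=> ul vl.
have -> : series (fun n => a * u n + b * v n) =
    (fun m => a * series u m + b * series v m).
  by apply/funext => m; rewrite /series /= big_split /= !mulr_sumr.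
by apply: cvgD; apply: cvgMr.
Qed.

Lemma nneg_series_is_cvg u (N : nat) (B : R) : (forall n, 0 <= u n) ->
  (forall m, \sum_(N <= n < m) u n <= B) -> cvgn (fun m => \sum_(N <= n < m) u n).
Proof.
move=> u0 uB; apply: nondecreasing_is_cvgn.
  by apply: (nondecreasing_series (P := xpredT)) => n _ _; exact: u0.
by exists B => _ [m _ <-].
Qed.

Lemma series_partial_le u l m : (forall n, 0 <= u n) ->
  series u @ \oo --> l -> series u m <= l.
Proof.
move=> u0 ul; rewrite -(cvg_lim _ ul) //; apply: nondecreasing_cvgn_le.
  by apply: nondecreasing_series => n _ _; exact: u0.
by apply/cvg_ex; exists l.
Qed.

Lemma cvg_series_le u v l l' : (forall n, u n <= v n) ->
  series u @ \oo --> l -> series v @ \oo --> l' -> l <= l'.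
Proof.
move=> uv ul vl; apply: (ler_cvg_to ul vl); apply: nearW => m.
by apply: ler_sum => n _; exact: uv.
Qed.

Lemma cvg_series_ge0 u l : (forall n, 0 <= u n) -> series u @ \oo --> l -> 0 <= l.
Proof. by move=> u0 /(series_partial_le 0 u0); rewrite /series /= big_geq. Qed.

Lemma cvg_series_split u (N : nat) l :
  (fun m => \sum_(N <= n < m) u n) @ \oo --> l ->
  series u @ \oo --> \sum_(0 <= n < N) u n + l.
Proof.
move=> ul.
have h : (fun m => \sum_(0 <= n < N) u n + \sum_(N <= n < m) u n) @ \oo -->
    \sum_(0 <= n < N) u n + l by apply: cvgD => //; exact: cvg_cst.
apply: cvg_trans h; apply: near_eq_cvg; near=> m.
rewrite /series /= -big_cat_nat //=.
by near: m; exists N.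
Unshelve. all: by end_near. Qed.

Lemma nneseries_EFin u l : (forall n, 0 <= u n) -> series u @ \oo --> l ->
  (\sum_(0 <= n <oo) (u n)%:E)%E = l%:E.
Proof.
move=> u0 ul; apply: cvg_lim => //.
rewrite (_ : (fun m => _) = EFin \o series u).
  by apply: cvg_EFin => //; exact: nearW.
by apply/funext => m /=; rewrite sumEFin.
Qed.

Definition convolution u v (n : nat) : R := \sum_(0 <= m < n.+1) u m * v (n - m)%N.

Lemma series_convolution u v n :
  series (convolution u v) n = \sum_(0 <= i < n) u i * series v (n - i)%N.
Proof.
elim: n => [|n IH]; first by rewrite /series /= !big_geq.
rewrite seriesSr IH /convolution big_nat_recr //= [X in _ = X]big_nat_recr //=.
rewrite subnn subSnn addrA; congr (_ + _); last first.
  by rewrite /series /= big_nat1.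
rewrite -big_split /= [RHS]big_nat [LHS]big_nat; apply: eq_bigr => i /andP[_ ltin].
by rewrite subSn ?(ltnW ltin) // seriesSr mulrDr.
Qed.

(** The triangle i + j < n lies in the square of side n, and the triangle of size 2m contains the
    square of side m, so the partial sums are squeezed. *)
Lemma cvg_series_convolution u v l l' :
  (forall n, 0 <= u n) -> (forall n, 0 <= v n) ->
  series u @ \oo --> l -> series v @ \oo --> l' ->
  series (convolution u v) @ \oo --> l * l'.
Proof.
move=> u0 v0 ul vl.
have uv0 n : 0 <= convolution u v n by apply: sumr_ge0 => m _; rewrite mulr_ge0.
have nd : nondecreasing_seq (series (convolution u v)).
  by apply: nondecreasing_series => n _ _; exact: uv0.
have ub m : series (convolution u v) m <= l * l'.
  rewrite series_convolution.
  apply: (@le_trans _ _ (series u m * l')); last first.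
    by rewrite ler_wpM2r ?(series_partial_le m u0 ul) // (cvg_series_ge0 v0 vl).
  rewrite /series /= mulr_suml; apply: ler_sum => i _.
  by rewrite ler_wpM2l // (series_partial_le _ v0 vl).
have cv : cvgn (series (convolution u v)).
  by apply: nondecreasing_is_cvgn => //; exists (l * l') => _ [m _ <-].
suff le : l * l' <= limn (series (convolution u v)).
  have -> : l * l' = limn (series (convolution u v)) => //.
  apply/eqP; rewrite eq_le le /=; apply: limr_le => //.
  by apply: nearW => m; exact: ub.
apply: (ler_cvg_to (cvgM ul vl) (cvg_cst _)).
apply: nearW => m.
apply: le_trans (nondecreasing_cvgn_le nd cv (m + m)%N).
rewrite series_convolution /series /= mulr_suml [leRHS](big_cat_nat _ (n := m)) ?leq_addr //=.
rewrite -[leLHS]addr0; apply: lerD.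
  rewrite big_nat [leRHS]big_nat; apply: ler_sum => i /andP[_ im].
  rewrite ler_wpM2l // (nondecreasing_series (P := xpredT)) //.
  by rewrite -addnBA ?leq_addr // ltnW.
by apply: sumr_ge0 => i _; rewrite mulr_ge0 // sumr_ge0.
Qed.

(** * Power series with nonnegative coefficients near 1 *)

Lemma power_sum_continuous c (k : nat -> nat) N m (a : R) :
  \sum_(N <= n < m) c n * x ^+ k n @[x --> a] --> \sum_(N <= n < m) c n * a ^+ k n.
Proof.
pose P := \sum_(N <= n < m) c n *: 'X^(k n) : {poly R}.
have PE x : \sum_(N <= n < m) c n * x ^+ k n = P.[x].
  by rewrite /P horner_sum; apply: eq_bigr => n _; rewrite hornerZ hornerXn.
rewrite PE; under eq_fun do rewrite PE.
apply: differentiable_continuous; apply/derivable1_diffP.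
exact: ex_derive.
Qed.

(** Abel's theorem, where nonnegativity makes both halves elementary: for x <= 1 the sum is at most
    L, and a partial sum close to L is a polynomial, continuous at 1. The exponent map [k] is [id]
    or [predn] in use, for x^n and x^(n-1). *)
Lemma power_series_left_limit c (k : nat -> nat) N :
  (forall n, 0 <= c n) -> cvgn (fun m => \sum_(N <= n < m) c n) ->
  limn (fun m => \sum_(N <= n < m) c n * x ^+ k n) @[x --> 1^'-] -->
  limn (fun m => \sum_(N <= n < m) c n).
Proof.
move=> c0 cc; set L := limn _.
have nd w : (forall n, 0 <= w n) -> nondecreasing_seq (fun m => \sum_(N <= n < m) w n : R).
  by move=> w0; apply: (nondecreasing_series (P := xpredT)) => n _ _; exact: w0.
have Lge m : \sum_(N <= n < m) c n <= L by exact: (nondecreasing_cvgn_le (nd _ c0) cc).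
apply/cvgrPdist_le => e e0.
have e2 : 0 < e / 2 by rewrite divr_gt0.
have [M ML] : exists M, L - e / 2 <= \sum_(N <= n < M) c n.
  have : \forall m \near \oo, L - e / 2 <= \sum_(N <= n < m) c n.
    by apply: (lt_lim (nd _ c0) cc); rewrite -/L ltrBlDr ltrDl.
  by case=> M _ h; exists M; apply: h => /=.
have hM : \sum_(N <= n < M) c n * x ^+ k n @[x --> 1^'-] --> \sum_(N <= n < M) c n * 1 ^+ k n.
  by apply: cvg_at_left_filter; exact: power_sum_continuous.
have {}hM := (cvgrPdist_le _ _).1 hM _ e2.
near=> x.
have x0 : 0 <= x by near: x; exact: nbhs_left_ge.
have x1 : x <= 1 by apply: ltW; near: x; exact: nbhs_left_lt.
have cx0 n : 0 <= c n * x ^+ k n by rewrite mulr_ge0 ?exprn_ge0.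
have cxle m : \sum_(N <= n < m) c n * x ^+ k n <= L.
  apply: le_trans (Lge m); apply: ler_sum => n _.
  by rewrite ler_piMr // exprn_ile1.
have ccx : cvgn (fun m => \sum_(N <= n < m) c n * x ^+ k n) by exact: (nneg_series_is_cvg cx0 cxle).
have up : limn (fun m => \sum_(N <= n < m) c n * x ^+ k n) <= L.
  by apply: limr_le => //; apply: nearW => m; exact: cxle.
have lo := nondecreasing_cvgn_le (nd _ cx0) ccx M.
have hx : `|\sum_(N <= n < M) c n * 1 ^+ k n - \sum_(N <= n < M) c n * x ^+ k n| <= e / 2.
  by near: x; exact: hM.
have E1 : \sum_(N <= n < M) c n * 1 ^+ k n = \sum_(N <= n < M) c n.
  by apply: eq_bigr => n _; rewrite expr1n mulr1.
rewrite ger0_norm ?subr_ge0 //.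
move: hx; rewrite E1 ler_norml => /andP[_ hx].
have := ML; move: lo hx => /=.
by move: (limn _) (\sum_(_ <= _ < _) _) (\sum_(_ <= _ < _) _) => s1 s2 s3; lra.
Unshelve. all: by end_near. Qed.

(** Convergence inside (0, 1) is assumed because [limn] of a divergent sequence is a default
    value. *)
Lemma power_series_left_pinfty c (k : nat -> nat) N :
  (forall n, 0 <= c n) -> ~ cvgn (fun m => \sum_(N <= n < m) c n) ->
  (forall x, 0 < x < 1 -> cvgn (fun m => \sum_(N <= n < m) c n * x ^+ k n)) ->
  limn (fun m => \sum_(N <= n < m) c n * x ^+ k n) @[x --> 1^'-] --> +oo.
Proof.
move=> c0 cc cx.
have nd w : (forall n, 0 <= w n) -> nondecreasing_seq (fun m => \sum_(N <= n < m) w n : R).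
  by move=> w0; apply: (nondecreasing_series (P := xpredT)) => n _ _; exact: w0.
apply/cvgryPge => A.
have [M AM] : exists M, A + 1 <= \sum_(N <= n < M) c n.
  have /cvgryPge/(_ (A + 1)) := nondecreasing_dvgn_lt (nd _ c0) cc.
  by case=> M _ h; exists M; apply: h => /=.
have hM : \sum_(N <= n < M) c n * x ^+ k n @[x --> 1^'-] --> \sum_(N <= n < M) c n * 1 ^+ k n.
  by apply: cvg_at_left_filter; exact: power_sum_continuous.
have {}hM := (cvgrPdist_le _ _).1 hM _ (@ltr01 R).
near=> x.
have x0 : 0 < x by apply: (@lt_le_trans _ _ 2^-1) => //; near: x; apply: nbhs_left_ge; lra.
have x1 : x < 1 by near: x; exact: nbhs_left_lt.
have cx0 n : 0 <= c n * x ^+ k n by rewrite mulr_ge0 ?exprn_ge0 // ltW.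
have lo : \sum_(N <= n < M) c n * x ^+ k n <= limn (fun m => \sum_(N <= n < m) c n * x ^+ k n).
  by apply: (nondecreasing_cvgn_le (nd _ cx0)); apply: cx; rewrite x0.
apply: le_trans lo.
have hx : `|\sum_(N <= n < M) c n * 1 ^+ k n - \sum_(N <= n < M) c n * x ^+ k n| <= 1.
  by near: x; exact: hM.
have E1 : \sum_(N <= n < M) c n * 1 ^+ k n = \sum_(N <= n < M) c n.
  by apply: eq_bigr => n _; rewrite expr1n mulr1.
move: hx; rewrite E1 ler_norml => /andP[_ hx].
by have := AM; move: hx; move: (\sum_(_ <= _ < _) _) (\sum_(_ <= _ < _) _) => s1 s2; lra.
Unshelve. all: by end_near. Qed.

End Sums.

(** * Moments of a renewal sequence *)

Section Moments.
Variable R : realType.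
Implicit Types (u f : R ^nat).

(** * Convergence of the series of n^e s^n *)

Lemma npow_ge0 n (e : R) : 0 <= npow n e. Proof. exact: powR_ge0. Qed.

Lemma npow_le_succ n (e : R) : e <= 1 -> npow n e <= n.+1%:R.
Proof.
move=> e1; case: n => [|n].
  rewrite /npow; have [->|e0] := eqVneq e 0; first by rewrite powRr0.
  by rewrite powR0.
by apply: (@le_trans _ _ n.+1%:R); [rewrite ler1_powR // ler1n|rewrite ler_nat].
Qed.

(** The terms are dominated by (n + 1) s^n, the convolution of the geometric sequence with itself.
    The condition e <= 1 covers -(d - 5)/2 from d = 3 on. *)
Lemma is_cvg_npow_geometric N (e s : R) : e <= 1 -> 0 <= s < 1 ->
  cvgn (fun m => \sum_(N <= n < m) npow n e * s ^+ n).
Proof.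
move=> e1 /andP[s0 s1].
suff : cvgn (series (fun n => npow n e * s ^+ n)) by rewrite -(is_cvg_series_restrict N).
have g : series (fun n => s ^+ n) @ \oo --> (1 - s)^-1.
  have -> : (fun n => s ^+ n) = geometric 1 s by apply/funext => n; rewrite /= mul1r.
  by rewrite -[_^-1]div1r; apply: cvg_geometric_series; rewrite ger0_norm.
have s0n n : 0 <= s ^+ n by rewrite exprn_ge0.
have h := cvg_series_convolution s0n s0n g g.
apply: series_le_cvg; last by apply/cvg_ex; exists ((1 - s)^-1 * (1 - s)^-1); exact: h.
- by move=> n; rewrite mulr_ge0 ?npow_ge0.
- by move=> n; apply: sumr_ge0 => i _; rewrite mulr_ge0.
move=> n; rewrite /convolution big_mkord.
rewrite (eq_bigr (fun=> s ^+ n)) => [|i _]; last first.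
  by rewrite -exprD subnKC // -ltnS.
by rewrite sumr_const card_ord -mulr_natl ler_wpM2r // npow_le_succ.
Qed.

(** A discrete form of integrating x^(-3/2). With a and b the two square roots, it rests on (b -
    a)(b + a) = 1. *)
Lemma sqrt_inv_telescope n : (0 < n)%N ->
  (Num.sqrt n.+1%:R)^-1 ^+ 3 <= 2 * ((Num.sqrt n%:R)^-1 - (Num.sqrt n.+1%:R)^-1) :> R.
Proof.
move=> n0; set a := Num.sqrt n%:R; set b := Num.sqrt n.+1%:R.
have a0 : 0 < a by rewrite sqrtr_gt0 ltr0n.
have b0 : 0 < b by rewrite sqrtr_gt0 ltr0n.
have ab : a <= b by rewrite ler_wsqrtr // ler_nat.
have h : b ^+ 2 = a ^+ 2 + 1 by rewrite !sqr_sqrtr ?ler0n // natr1.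
rewrite -subr_ge0.
have -> : 2 * (a^-1 - b^-1) - b^-1 ^+ 3 = (2 * b ^+ 2 * (b - a) - a) / (a * b ^+ 3).
  by field; rewrite !gt_eqF.
apply: divr_ge0; last by rewrite ltW // mulr_gt0 // exprn_gt0.
have -> : 2 * b ^+ 2 * (b - a) - a =
    ((b - a) * (b + a) - 1) * a + (b - a) * (2 * b ^+ 2 - a * (b + a)) by ring.
have -> : (b - a) * (b + a) - 1 = 0 by rewrite -subr_sqr h; ring.
rewrite mul0r add0r mulr_ge0 ?subr_ge0 // expr2.
have h1 : a * b <= b * b by rewrite ler_pM2r.
have h2 : a * a <= b * b by rewrite ler_pM // ltW.
by rewrite mulrDr; move: (a * b) (a * a) (b * b) h1 h2 => x y z; lra.
Qed.

Lemma is_cvg_npow N (e : R) : e <= - (3 / 2) ->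
  cvgn (fun m => \sum_(N <= n < m) npow n e).
Proof.
move=> e1.
suff : cvgn (series (fun n => npow n e)) by rewrite -(is_cvg_series_restrict N).
apply: (nneg_series_is_cvg (N := 0%N) (B := 4)) => [n|m]; first exact: npow_ge0.
have s0 n : 0 <= (Num.sqrt n%:R)^-1 :> R by rewrite invr_ge0 sqrtr_ge0.
suff H k : \sum_(0 <= n < k.+2) npow n e <= 4 - 2 * (Num.sqrt k.+1%:R)^-1.
  apply: (@le_trans _ _ (\sum_(0 <= n < m.+2) npow n e)).
    by rewrite 2?big_nat_recr //= -addrA lerDl addr_ge0 ?npow_ge0.
  by apply: (le_trans (H m)); have := s0 m.+1; lra.
elim: k => [|k IH].
  rewrite 2?big_nat_recr //= big_geq // add0r sqrtr1 invr1 /npow powR1.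
  rewrite powR0 ?add0r; first by lra.
  by rewrite lt_eqF //; lra.
rewrite big_nat_recr //=.
have h1 : npow k.+2 e <= npow k.+2 (- (3%:R / 2)) by rewrite ler_powR // ler1n.
have := lerD IH (le_trans h1 _ : _ <= 2 * ((Num.sqrt k.+1%:R)^-1 - (Num.sqrt k.+2%:R)^-1)).
rewrite npow_half // => /(_ (sqrt_inv_telescope (ltn0Sn k))) /le_trans; apply.
by set x := (Num.sqrt k.+1%:R)^-1; set y := (Num.sqrt k.+2%:R)^-1; lra.
Qed.

Lemma not_cvg_npow N (e : R) : -1 <= e <= 0 ->
  ~ cvgn (fun m => \sum_(N <= n < m) npow n e).
Proof.
move=> /andP[e1 e0] /=.
rewrite (is_cvg_series_restrict N (fun n => npow n e)) => /cvg_ex[l hl].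
apply: (@dvg_riemannR R (- e)); first by rewrite oppr_ge0 e0 lerNl.
apply: (nneg_series_is_cvg (N := 0%N) (B := l)) => [n|m].
  by rewrite ltW // riemannR_gt0 // oppr_ge0.
have := series_partial_le m.+1 (fun n => npow_ge0 n e) hl.
apply: le_trans; rewrite /series /= big_nat_recl //= -[leLHS]add0r.
rewrite lerD ?npow_ge0 // le_eqVlt; apply/orP; left; apply/eqP.
by apply: eq_bigr => n _; rewrite /npow /riemannR powRN invrK.
Qed.

Lemma cvg_series_dominated u c N (K : R) : (forall n, 0 <= u n) -> (forall n, 0 <= c n) ->
  (forall n, (N <= n)%N -> u n <= K * c n) -> 0 <= K ->
  cvgn (fun m => \sum_(N <= n < m) c n) ->
  exists2 l : R, series u @ \oo --> l &
    l <= \sum_(0 <= n < N) u n + K * limn (fun m => \sum_(N <= n < m) c n).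
Proof.
move=> u0 c0 uc K0 cc; set L := limn _.
have cL m : \sum_(N <= n < m) c n <= L.
  apply: nondecreasing_cvgn_le => //.
  by apply: (nondecreasing_series (P := xpredT)) => n _ _; exact: c0.
have uL m : \sum_(N <= n < m) u n <= K * L.
  apply: (@le_trans _ _ (K * \sum_(N <= n < m) c n)); last by rewrite ler_wpM2l.
  rewrite mulr_sumr big_nat [leRHS]big_nat; apply: ler_sum => n /andP[Nn _].
  exact: uc.
have cu := nneg_series_is_cvg u0 uL.
exists (\sum_(0 <= n < N) u n + limn (fun m => \sum_(N <= n < m) u n)).
  exact: cvg_series_split cu.
by rewrite lerD2l; apply: limr_le => //; apply: nearW => m; exact: uL.
Qed.

Lemma cvg_series_minorized u c N (K l : R) : (forall n, 0 <= u n) -> (forall n, 0 <= c n) ->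
  (forall n, (N <= n)%N -> K * c n <= u n) ->
  cvgn (fun m => \sum_(N <= n < m) c n) -> series u @ \oo --> l ->
  \sum_(0 <= n < N) u n + K * limn (fun m => \sum_(N <= n < m) c n) <= l.
Proof.
move=> u0 c0 uc cc ul.
have h : (fun m => \sum_(0 <= n < N) u n + K * \sum_(N <= n < m) c n) @ \oo -->
    \sum_(0 <= n < N) u n + K * limn (fun m => \sum_(N <= n < m) c n).
  by apply: cvgD; [exact: cvg_cst|exact: cvgMr].
apply: (ler_cvg_to h ul); near=> m.
have Nm : (N <= m)%N by near: m; exists N.
rewrite /series /= [leRHS](big_cat_nat _ (n := N)) //= lerD2l mulr_sumr.
by rewrite [leLHS]big_nat [leRHS]big_nat; apply: ler_sum => n /andP[Nn _]; exact: uc.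
Unshelve. all: by end_near. Qed.

(* The moments of [u] and [f] satisfy the derivatives of U = 1 + F U at 1. *)
Lemma renewal_moments u f (A0 A1 A2 : R) :
  (forall n, 0 <= u n) -> (forall n, 0 <= f n) -> f 0%N = 0 ->
  (forall n, u n = (n == 0%N)%:R + convolution f u n) ->
  series u @ \oo --> A0 -> series (fun n => n%:R * u n) @ \oo --> A1 ->
  series (fun n => (n ^ 2)%:R * u n) @ \oo --> A2 ->
  exists B0 B1 B2 : R, [/\ series f @ \oo --> B0,
    series (fun n => n%:R * f n) @ \oo --> B1,
    series (fun n => (n ^ 2)%:R * f n) @ \oo --> B2 &
    [/\ A0 = 1 + B0 * A0, A1 = B1 * A0 + B0 * A1 & A2 = B2 * A0 + 2 * (B1 * A1) + B0 * A2]].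
Proof.
move=> u0 f0 f00 ren hA0 hA1 hA2.
have u00 : u 0%N = 1 by rewrite ren /convolution big_nat1 f00 mul0r addr0.
(* The last term of the convolution is f n, as u 0 = 1; hence each moment of f converges with that
   of u. *)
have fu n : f n <= u n.
  rewrite ren /convolution big_nat_recr //= subnn u00 mulr1 addrA lerDr.
  by rewrite addr_ge0 // sumr_ge0 // => i _; rewrite mulr_ge0.
have ex (w : R ^nat) (l : R) : (forall n, 0 <= w n) -> series (fun n => w n * u n) @ \oo --> l ->
    exists B : R, series (fun n => w n * f n) @ \oo --> B.
  move=> w0 hl; suff /cvg_ex[B hB] : cvgn (series (fun n => w n * f n)) by exists B.
  apply: (@series_le_cvg _ _ (fun n => w n * u n)).
  - by move=> n; rewrite mulr_ge0.
  - by move=> n; rewrite mulr_ge0.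
  - by move=> n; rewrite ler_wpM2l.
  by apply/cvg_ex; exists l.
have mul1 (v : R ^nat) : (fun n => 1 * v n) = v by apply/funext => n; rewrite mul1r.
have [B0 hB0] : exists B : R, series f @ \oo --> B.
  by have := ex (fun=> 1) A0 (fun=> ler01); rewrite !mul1; apply.
have [B1 hB1] := ex _ _ (fun n => ler0n R n) hA1.
have [B2 hB2] := ex _ _ (fun n => ler0n R (n ^ 2)) hA2.
exists B0, B1, B2; split=> //.
have n0f (w : nat -> nat) n : 0 <= (w n)%:R * f n by rewrite mulr_ge0.
have n0u (w : nat -> nat) n : 0 <= (w n)%:R * u n by rewrite mulr_ge0.
have c00 := cvg_series_convolution f0 u0 hB0 hA0.
have c10 := cvg_series_convolution (n0f id) u0 hB1 hA0.
have c01 := cvg_series_convolution f0 (n0u id) hB0 hA1.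
have c20 := cvg_series_convolution (n0f (expn^~ 2%N)) u0 hB2 hA0.
have c11 := cvg_series_convolution (n0f id) (n0u id) hB1 hA1.
have c02 := cvg_series_convolution f0 (n0u (expn^~ 2%N)) hB0 hA2.
have delta : series (fun n => (n == 0%N)%:R : R) @ \oo --> (1 : R).
  apply: cvg_near_cst; near=> m.
  have m0 : (0 < m)%N by near: m; exists 1%N.
  rewrite /series /= big_ltn //= big_nat big1 ?addr0 // => i /andP[i0 _].
  by rewrite gtn_eqF.
have eqs (v w : R ^nat) (l : R) : v =1 w -> series v @ \oo --> l -> series w @ \oo --> l.
  by move=> /funext ->.
have nE m n : (m < n.+1)%N -> n%:R = m%:R + (n - m)%:R :> R.
  by move=> mn; rewrite -natrD subnKC.
(* The weights n and n^2 remove delta_0; expanding them by n = m + (n - m) then produces the Cauchy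
   products above. *)
have n0d n k : (n ^ k.+1)%:R * ((n == 0%N)%:R + convolution f u n) =
    (n ^ k.+1)%:R * convolution f u n.
  by case: n => [|n]; rewrite ?exp0n ?mul0r // add0r.
split.
- apply: (cvg_unique _ hA0) => //.
  have := cvg_series_lin (a := 1) (b := 1) delta c00; rewrite !mul1r; apply: eqs => n.
  by rewrite /= !mul1r -ren.
- apply: (cvg_unique _ hA1) => //.
  have := cvg_series_lin (a := 1) (b := 1) c10 c01; rewrite !mul1r; apply: eqs => n.
  rewrite /= !mul1r ren; have := n0d n 0%N; rewrite expn1 => ->.
  rewrite /convolution mulr_sumr -big_split /=.
  rewrite big_nat [RHS]big_nat; apply: eq_bigr => m /andP[_ mn].
  by rewrite (nE m n mn); ring.
- apply: (cvg_unique _ hA2) => //.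
  have := cvg_series_lin (a := 1) (b := 1) (cvg_series_lin (a := 1) (b := 2) c20 c11) c02.
  rewrite !mul1r; apply: eqs => n.
  rewrite /= !mul1r ren n0d /convolution !mulr_sumr -!big_split /=.
  rewrite big_nat [RHS]big_nat; apply: eq_bigr => m /andP[_ mn].
  by rewrite !natrX (nE m n mn); ring.
Unshelve. all: by end_near. Qed.

(** Let Z, G, Y be the sums of n f_n, f_n, n^2 f_n over n > c. Since (n - c) f_n <= n f_n for n > c
    and (n - c) f_n <= 0 elsewhere, Z >= B1 - c B0 = B1 (1 - 1/t). Cauchy-Schwarz gives Z^2 <= Y G
    <= B2 G, so Z / G <= B2 / Z. *)
Lemma tail_mean_le f (B0 B1 B2 t : R) : (forall n, 0 <= f n) -> 1 < t ->
  0 < B0 -> 0 < B1 ->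
  series f @ \oo --> B0 -> series (fun n => n%:R * f n) @ \oo --> B1 ->
  series (fun n => (n ^ 2)%:R * f n) @ \oo --> B2 ->
  let c := B1 / B0 / t in exists Z G : R,
  [/\ series (fun n => if c < n%:R then n%:R * f n else 0) @ \oo --> Z,
      series (fun n => if c < n%:R then f n else 0) @ \oo --> G &
      Z / G <= t / (t - 1) * (B2 / B1)].
Proof.
move=> f0 t1 B00 B10 h0 h1 h2 c.
have c0 : 0 <= c by rewrite divr_ge0 ?divr_ge0 ?ltW //; lra.
have ex (w : R ^nat) (l : R) : (forall n, 0 <= w n) -> series (fun n => w n * f n) @ \oo --> l ->
    exists2 B : R, series (fun n => if c < n%:R then w n * f n else 0) @ \oo --> B & B <= l.
  move=> w0 hl; have le n : (if c < n%:R then w n * f n else 0) <= w n * f n.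
    by case: ifP => // _; rewrite mulr_ge0.
  suff /cvg_ex[B hB] : cvgn (series (fun n => if c < n%:R then w n * f n else 0)).
    by exists B => //; apply: (cvg_series_le le hB hl).
  apply: (@series_le_cvg _ _ (fun n => w n * f n)) => //.
  - by move=> n; case: ifP => // _; rewrite mulr_ge0.
  - by move=> n; rewrite mulr_ge0.
  by apply/cvg_ex; exists l.
have [Z hZ _] := ex _ _ (fun n => ler0n R n) h1.
have [Y hY YB] := ex _ _ (fun n => ler0n R (n ^ 2)) h2.
have [G hG _] : exists2 B : R, series (fun n => if c < n%:R then f n else 0) @ \oo --> B & B <= B0.
  have e1 : (fun n => 1 * f n) = f by apply/funext => n; rewrite mul1r.
  have e2 : (fun n => if c < n%:R then 1 * f n else 0) = (fun n => if c < n%:R then f n else 0).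
    by apply/funext => n; rewrite mul1r.
  by have := ex (fun=> 1) B0 (fun=> ler01); rewrite e1 e2; apply.
exists Z, G; split=> //.
have Zge : B1 * (1 - t^-1) <= Z.
  have := cvg_series_lin (a := 1) (b := (- c)) h1 h0 => hl.
  have -> : B1 * (1 - t^-1) = 1 * B1 + - c * B0.
    by rewrite /c; field; rewrite !gt_eqF //; lra.
  apply: (cvg_series_le _ hl hZ) => n.
  case: ifPn => [cn|]; first by rewrite mul1r mulNr gerBl mulr_ge0.
  rewrite -leNgt => nc; rewrite mul1r -mulrDl mulr_le0_ge0 //; lra.
have Z0 : 0 < Z.
  by apply: lt_le_trans Zge; rewrite mulr_gt0 // subr_gt0 invf_lt1 //; lra.
(* Cauchy-Schwarz through a quadratic in w: w = Z / G yields it, and G = 0 is excluded by w = (Y +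
   1) / Z, where the value would be - Y - 2. *)
have quad w : 0 <= Y - 2 * w * Z + w ^+ 2 * G.
  have hl := cvg_series_lin (a := 1) (b := (w ^+ 2))
    (cvg_series_lin (a := 1) (b := (- (2 * w))) hY hZ) hG.
  have -> : Y - 2 * w * Z + w ^+ 2 * G = 1 * (1 * Y + - (2 * w) * Z) + w ^+ 2 * G by ring.
  apply: (cvg_series_ge0 _ hl) => n; case: ifP => _; last by rewrite !mulr0 !addr0.
  rewrite natrX (_ : _ + _ = f n * (n%:R - w) ^+ 2); last by ring.
  by rewrite mulr_ge0 ?sqr_ge0.
have Y0 : 0 <= Y.
  by apply: (cvg_series_ge0 _ hY) => n; case: ifP => // _; rewrite mulr_ge0.
have G0 : 0 < G.
  rewrite lt_neqAle; apply/andP; split.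
    apply/eqP => G0; have := quad ((Y + 1) / Z).
    rewrite -G0 mulr0 addr0 (_ : 2 * _ * Z = 2 * (Y + 1)); last by field; rewrite gt_eqF.
    lra.
  by apply: (cvg_series_ge0 _ hG) => n; case: ifP.
have ZYG : Z ^+ 2 <= Y * G.
  have := quad (Z / G).
  rewrite (_ : Y - 2 * (Z / G) * Z + (Z / G) ^+ 2 * G = (Y * G - Z ^+ 2) / G); last first.
    by field; rewrite gt_eqF.
  by rewrite pmulr_lge0 ?invr_gt0 // subr_ge0.
have t0 : 0 < t - 1 by lra.
have B20 : 0 <= B2 by apply: le_trans YB.
apply: (@le_trans _ _ (B2 / Z)).
  rewrite ler_pdivrMr // mulrAC ler_pdivlMr // -expr2 (le_trans ZYG) //.
  by rewrite ler_pM2r.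
rewrite [leRHS](_ : _ = B2 / (B1 * (1 - t^-1))); last first.
  by field; rewrite !gt_eqF //; lra.
rewrite ler_wpM2l // lef_pV2 ?posrE // mulr_gt0 // subr_gt0 invf_lt1 //; lra.
Qed.

End Moments.

(** * Limits of the bounds at 1 *)

Section Assembly.
Variables (R : realType) (d : nat) (p : 'I_d -> R).
Hypothesis d3 : (3 <= d)%N.
Hypothesis p01 : forall j, 0 < p j < 1.

Let d0 : (0 < d)%N. Proof. exact: leq_trans d3. Qed.
Let dE : 3 <= d%:R :> R. Proof. by rewrite ler_nat. Qed.
Let T0 := TT_gt0 p01.
Let a0 := alphaP_gt0 p01.

(** The coefficient left when the powers of x are taken out of the tail of [UB_phi], [LB_dphi] or
    [UB_dphi2]; e is -(d - 1)/2, -(d - 3)/2 or -(d - 5)/2 respectively. *)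
Definition rr_majorant (e : R) (n : nat) : R := npow n e * TT p ^+ n.

Lemma rr_majorant_ge0 e n : 0 <= rr_majorant e n.
Proof. by rewrite mulr_ge0 ?npow_ge0 ?exprn_ge0 // ltW. Qed.

Lemma is_cvg_rr_majorant N e : (TT p < 1 /\ e <= 1) \/ (TT p = 1 /\ e <= - (3 / 2)) ->
  cvgn (fun m => \sum_(N <= n < m) rr_majorant e n).
Proof.
case=> -[T1 e1]; first by apply: is_cvg_npow_geometric; rewrite // T1 ltW.
rewrite (_ : (fun m => _) = fun m => \sum_(N <= n < m) npow n e); first exact: is_cvg_npow.
by apply/funext => m; apply: eq_bigr => n _; rewrite /rr_majorant T1 expr1n mulr1.
Qed.

Lemma natr_npow n (e : R) : (0 < n)%N -> n%:R * npow n e = npow n (e + 1).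
Proof.
move=> n0; rewrite /npow powRD ?powRr1 1?mulrC //.
by apply/implyP => _; rewrite pnatr_eq0 -lt0n.
Qed.

Lemma tailE N e x :
  limn (fun m => \sum_(N <= n < m) npow n e * (TT p * x) ^+ n) =
  limn (fun m => \sum_(N <= n < m) rr_majorant e n * x ^+ n).
Proof.
congr (limn _); apply/funext => m; apply: eq_bigr => n _.
by rewrite exprMn mulrA.
Qed.

Lemma tail_predE N e x : (0 < N)%N -> x != 0 ->
  limn (fun m => \sum_(N <= n < m) npow n e * x^-1 * (TT p * x) ^+ n) =
  limn (fun m => \sum_(N <= n < m) rr_majorant e n * x ^+ n.-1).
Proof.
move=> N0 x0; congr (limn _); apply/funext => m; rewrite big_nat [RHS]big_nat.
apply: eq_bigr => n /andP[Nn _]; have n0 : (0 < n)%N by apply: leq_trans Nn.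
have xn : x ^+ n = x * x ^+ n.-1 by rewrite -exprS prednK.
by rewrite /rr_majorant exprMn xn; field.
Qed.

Lemma sum_expr1 N (c : nat -> R) (k : nat -> nat) :
  limn (fun m => \sum_(N <= n < m) c n * 1 ^+ k n) = limn (fun m => \sum_(N <= n < m) c n).
Proof.
by congr (limn _); apply/funext => m; apply: eq_bigr => n _; rewrite expr1n mulr1.
Qed.

Lemma tail_left_limit N e : cvgn (fun m => \sum_(N <= n < m) rr_majorant e n) ->
  limn (fun m => \sum_(N <= n < m) npow n e * (TT p * x) ^+ n) @[x --> 1^'-] -->
  limn (fun m => \sum_(N <= n < m) npow n e * (TT p * 1) ^+ n).
Proof.
move=> cv; rewrite tailE sum_expr1.
under eq_fun do rewrite tailE.
exact: (power_series_left_limit id (rr_majorant_ge0 e) cv).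
Qed.

Lemma tail_pred_left_near N e : (0 < N)%N ->
  \forall x \near 1^'-,
  limn (fun m => \sum_(N <= n < m) rr_majorant e n * x ^+ n.-1) =
  limn (fun m => \sum_(N <= n < m) npow n e * x^-1 * (TT p * x) ^+ n).
Proof.
by move=> N0; near=> x; rewrite tail_predE // gt_eqF.
Unshelve. all: by end_near. Qed.

Lemma tail_pred_left_limit N e : (0 < N)%N ->
  cvgn (fun m => \sum_(N <= n < m) rr_majorant e n) ->
  limn (fun m => \sum_(N <= n < m) npow n e * x^-1 * (TT p * x) ^+ n) @[x --> 1^'-] -->
  limn (fun m => \sum_(N <= n < m) npow n e * 1^-1 * (TT p * 1) ^+ n).
Proof.
move=> N0 cv; rewrite tail_predE ?oner_neq0 // sum_expr1.
apply: cvg_trans (power_series_left_limit predn (rr_majorant_ge0 e) cv).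
by apply: near_eq_cvg; exact: tail_pred_left_near.
Qed.

(** For T = 1 the coefficients are n^e. The range of e contains -1/2 and -1, the exponents of
    [UB_dphi2] for d = 6 and d = 7. *)
Lemma tail_pred_left_pinfty N e : (0 < N)%N -> TT p = 1 -> -1 <= e <= 0 ->
  limn (fun m => \sum_(N <= n < m) npow n e * x^-1 * (TT p * x) ^+ n) @[x --> 1^'-] --> +oo.
Proof.
move=> N0 T1 e10; have /andP[e1 e0] := e10.
have cE : rr_majorant e = npow (R := R) ^~ e.
  by apply/funext => n; rewrite /rr_majorant T1 expr1n mulr1.
suff lim : limn (fun m => \sum_(N <= n < m) rr_majorant e n * x ^+ n.-1) @[x --> 1^'-] --> +oo.
  by apply: cvg_trans lim; apply: near_eq_cvg; exact: tail_pred_left_near.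
apply: power_series_left_pinfty.
- exact: rr_majorant_ge0.
- by rewrite cE; exact: not_cvg_npow.
move=> x /andP[x0 x1].
have cv : cvgn (fun m => \sum_(N <= n < m) npow n e * x ^+ n).
  by apply: is_cvg_npow_geometric; [lra|rewrite x1 ltW].
have -> : (fun m => \sum_(N <= n < m) rr_majorant e n * x ^+ n.-1) =
    (fun m => x^-1 * \sum_(N <= n < m) npow n e * x ^+ n).
  apply/funext => m; rewrite mulr_sumr big_nat [RHS]big_nat.
  apply: eq_bigr => n /andP[Nn _]; have n0 : (0 < n)%N by apply: leq_trans Nn.
  have xn : x ^+ n = x * x ^+ n.-1 by rewrite -exprS prednK.
  by rewrite cE xn; field; rewrite gt_eqF.
exact: is_cvgMr.
Qed.

Lemma Nc_gt0 (l : R) : (0 < Nc (alphaP p) l)%N.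
Proof. by rewrite leq_max. Qed.

Lemma Lc_gt0 (l : R) : (0 < Lc (alphaP p) l)%N.
Proof. by rewrite leq_max. Qed.

Lemma UB_phi_left_limit (l : R) :
  cvgn (fun m => \sum_(Nc (alphaP p) l <= n < m) rr_majorant (- ((d%:R - 1) / 2)) n) ->
  UB_phi p x l @[x --> 1^'-] --> UB_phi p 1 l.
Proof.
move=> cv; rewrite /UB_phi; apply: cvgD.
  exact: cvg_at_left_filter (@power_sum_continuous R (rr p) id 1%N (Nc (alphaP p) l) 1).
by apply: cvgMr; exact: tail_left_limit.
Qed.

Lemma LB_dphi_left_limit (l : R) :
  cvgn (fun m => \sum_(Lc (alphaP p) l <= n < m) rr_majorant (- ((d%:R - 3) / 2)) n) ->
  LB_dphi p x l @[x --> 1^'-] --> LB_dphi p 1 l.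
Proof.
move=> cv; rewrite /LB_dphi; apply: cvgD.
  exact: cvg_at_left_filter
    (@power_sum_continuous R (fun n => n%:R * rr p n) predn 1%N (Lc (alphaP p) l) 1).
by apply: cvgMr; apply: tail_pred_left_limit => //; exact: Lc_gt0.
Qed.

Lemma UB_dphi2_left_limit (l : R) :
  cvgn (fun m => \sum_(Nc (alphaP p) l <= n < m) rr_majorant (- ((d%:R - 5) / 2)) n) ->
  UB_dphi2 p x l @[x --> 1^'-] --> UB_dphi2 p 1 l.
Proof.
move=> cv; rewrite /UB_dphi2; apply: cvgD.
  exact: cvg_at_left_filter
    (@power_sum_continuous R (fun n => (n ^ 2)%:R * rr p n) predn 1%N (Nc (alphaP p) l) 1).
by apply: cvgMr; apply: tail_pred_left_limit => //; exact: Nc_gt0.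
Qed.

Lemma UB_const_gt0 (l : R) : 0 < l < 1 ->
  0 < (Mc (alphaP p) l / Num.sqrt (2 * pi)) ^+ d.-1.
Proof.
move=> /andP[l0 l1]; have pi0 := pi_gt0 R.
rewrite exprn_gt0 // !divr_gt0 ?mulr_gt0 ?sqrtr_gt0 ?mulr_gt0 ?subr_gt0 //.
by rewrite addr_gt0.
Qed.

Lemma LB_const_gt0 (l : R) : 0 < l < 1 ->
  0 < (Num.sqrt (2 * pi) / expR 2) ^+ d * Kc (alphaP p) d l.
Proof.
move=> l01; have pi0 := pi_gt0 R.
by rewrite mulr_gt0 ?Kc_gt0 // exprn_gt0 // divr_gt0 ?expR_gt0 // sqrtr_gt0 mulr_gt0.
Qed.

Lemma limn_majorant_gt0 N e : (0 < N)%N ->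
  cvgn (fun m => \sum_(N <= n < m) rr_majorant e n) ->
  0 < limn (fun m => \sum_(N <= n < m) rr_majorant e n).
Proof.
move=> N0 cv; apply: (@lt_le_trans _ _ (\sum_(N <= n < N.+1) rr_majorant e n)).
  by rewrite big_nat1 /rr_majorant mulr_gt0 ?exprn_gt0 // /npow powR_gt0 // ltr0n.
apply: nondecreasing_cvgn_le => //.
by apply: (nondecreasing_series (P := xpredT)) => n _ _; exact: rr_majorant_ge0.
Qed.

Lemma UB_phi1_ge0 (l : R) : 0 < l < 1 ->
  cvgn (fun m => \sum_(Nc (alphaP p) l <= n < m) rr_majorant (- ((d%:R - 1) / 2)) n) ->
  0 <= UB_phi p 1 l.
Proof.
move=> l01 cv; rewrite /UB_phi tailE sum_expr1 addr_ge0 //.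
  by apply: sumr_ge0 => n _; rewrite expr1n mulr1 rr_ge0.
by rewrite mulr_ge0 // ltW ?UB_const_gt0 ?limn_majorant_gt0 ?Nc_gt0.
Qed.

Lemma LB_dphi1_gt0 (l : R) : 0 < l < 1 ->
  cvgn (fun m => \sum_(Lc (alphaP p) l <= n < m) rr_majorant (- ((d%:R - 3) / 2)) n) ->
  0 < LB_dphi p 1 l.
Proof.
move=> l01 cv; rewrite /LB_dphi tail_predE ?oner_neq0 ?Lc_gt0 // sum_expr1.
apply: ltr_wpDl; last by rewrite mulr_gt0 ?LB_const_gt0 ?limn_majorant_gt0 ?Lc_gt0.
by apply: sumr_ge0 => n _; rewrite expr1n mulr1 mulr_ge0 ?rr_ge0.
Qed.

(** A factor n raises the exponent by 1, so the single bound [rr_le] serves all three series. *)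
Lemma rr_le_majorant n (l : R) : 0 < l < 1 -> (Nc (alphaP p) l <= n)%N ->
  [/\ rr p n <= (Mc (alphaP p) l / Num.sqrt (2 * pi)) ^+ d.-1 *
        rr_majorant (- ((d%:R - 1) / 2)) n,
      n%:R * rr p n <= (Mc (alphaP p) l / Num.sqrt (2 * pi)) ^+ d.-1 *
        rr_majorant (- ((d%:R - 3) / 2)) n &
      (n ^ 2)%:R * rr p n <= (Mc (alphaP p) l / Num.sqrt (2 * pi)) ^+ d.-1 *
        rr_majorant (- ((d%:R - 5) / 2)) n].
Proof.
move=> l01 Nn; have n0 : (0 < n)%N by apply: leq_trans Nn; exact: Nc_gt0.
have h := rr_le d0 p01 l01 Nn; rewrite /rr_majorant.
have -> : - ((d%:R - 5) / 2) = - ((d%:R - 1) / 2) + 1 + 1 :> R by lra.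
have -> : - ((d%:R - 3) / 2) = - ((d%:R - 1) / 2) + 1 :> R by lra.
rewrite -!natr_npow //; split; first by rewrite mulrA.
  rewrite [leRHS](_ : _ = n%:R * ((Mc (alphaP p) l / Num.sqrt (2 * pi)) ^+ d.-1 *
    npow n (- ((d%:R - 1) / 2)) * TT p ^+ n)); last by ring.
  by rewrite ler_wpM2l.
rewrite [leRHS](_ : _ = n%:R ^+ 2 * ((Mc (alphaP p) l / Num.sqrt (2 * pi)) ^+ d.-1 *
  npow n (- ((d%:R - 1) / 2)) * TT p ^+ n)); last by ring.
by rewrite natrX ler_wpM2l ?exprn_ge0.
Qed.

Lemma rr_ge_majorant n (l : R) : 0 < l < 1 -> (0 < n)%N ->
  (Num.sqrt (2 * pi) / expR 2) ^+ d * Kc (alphaP p) d l *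
    rr_majorant (- ((d%:R - 3) / 2)) n <= n%:R * rr p n.
Proof.
move=> l01 n0; have h := rr_ge_Kc d0 p01 l01 n0; rewrite /rr_majorant.
have -> : - ((d%:R - 3) / 2) = - ((d%:R - 1) / 2) + 1 :> R by lra.
rewrite -natr_npow //.
rewrite [leLHS](_ : _ = n%:R * ((Num.sqrt (2 * pi) / expR 2) ^+ d * Kc (alphaP p) d l *
  npow n (- ((d%:R - 1) / 2)) * TT p ^+ n)); last by ring.
by rewrite ler_wpM2l.
Qed.

Lemma rr0 : rr p 0 = 1.
Proof. by rewrite /rr big_nat1 bin0 !expr0 expr1n !mulr1. Qed.

(** The term r_0 = 1 is the summand 1 in 1 + UB, and the weights n and n^2 cancel it in the other
    sums. The strict 1 < A0 comes from r_1 > 0 and makes the probability of a rencontre positive. *)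
Lemma rr_moments (l1 l2 : R) : 0 < l1 < 1 -> 0 < l2 < 1 ->
  (forall N, cvgn (fun m => \sum_(N <= n < m) rr_majorant (- ((d%:R - 1) / 2)) n)) ->
  (forall N, cvgn (fun m => \sum_(N <= n < m) rr_majorant (- ((d%:R - 3) / 2)) n)) ->
  (forall N, cvgn (fun m => \sum_(N <= n < m) rr_majorant (- ((d%:R - 5) / 2)) n)) ->
  exists A0 A1 A2 : R,
  [/\ series (rr p) @ \oo --> A0, series (fun n => n%:R * rr p n) @ \oo --> A1,
      series (fun n => (n ^ 2)%:R * rr p n) @ \oo --> A2 &
      [/\ 1 < A0, A0 <= 1 + UB_phi p 1 l1, LB_dphi p 1 l2 <= A1 & A2 <= UB_dphi2 p 1 l1]].
Proof.
move=> l101 l201 cv1 cv3 cv5.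
have r0 n : 0 <= rr p n by exact: rr_ge0.
have K0 := ltW (UB_const_gt0 l101).
have [A0 hA0 UA0] := cvg_series_dominated r0 (rr_majorant_ge0 _)
  (fun n Nn => let: And3 h _ _ := rr_le_majorant l101 Nn in h) K0 (cv1 _).
have nr0 n : 0 <= n%:R * rr p n by rewrite mulr_ge0.
have [A1 hA1 _] := cvg_series_dominated nr0 (rr_majorant_ge0 _)
  (fun n Nn => let: And3 _ h _ := rr_le_majorant l101 Nn in h) K0 (cv3 _).
have n2r0 n : 0 <= (n ^ 2)%:R * rr p n by rewrite mulr_ge0.
have [A2 hA2 UA2] := cvg_series_dominated n2r0 (rr_majorant_ge0 _)
  (fun n Nn => let: And3 _ _ h := rr_le_majorant l101 Nn in h) K0 (cv5 _).
have LA1 := cvg_series_minorized nr0 (rr_majorant_ge0 _)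
  (fun n Ln => rr_ge_majorant l201 (leq_trans (Lc_gt0 l2) Ln)) (cv3 _) hA1.
exists A0, A1, A2; split=> //.
have cut N (w : nat -> R) (k : nat -> nat) : (0 < N)%N ->
    \sum_(0 <= n < N) w n = w 0%N + \sum_(1 <= n < N) w n * 1 ^+ k n.
  by move=> N0; rewrite big_ltn //; congr (_ + _); apply: eq_bigr => n _; rewrite expr1n mulr1.
split.
- have := series_partial_le 2 r0 hA0; rewrite /series /= 2?big_nat_recr //= big_geq // add0r rr0.
  apply: lt_le_trans; rewrite ltrDl; apply: lt_le_trans (rr_ge d0 p01 (ltn0Sn 0)).
  by rewrite /npow powR1 mulr1 expr1 (mulr_gt0 _ T0) // mulr_gt0 // exprn_gt0.
- apply: (le_trans UA0); rewrite /UB_phi tailE sum_expr1 addrA.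
  by rewrite (cut _ _ id) ?Nc_gt0 // rr0.
- apply: le_trans LA1; rewrite /LB_dphi tail_predE ?oner_neq0 ?Lc_gt0 // sum_expr1.
  by rewrite (cut _ _ predn) ?Lc_gt0 // mul0r add0r.
apply: (le_trans UA2); rewrite /UB_dphi2 tail_predE ?oner_neq0 ?Nc_gt0 // sum_expr1.
by rewrite (cut _ _ predn) ?Nc_gt0 // mul0r add0r.
Qed.

(** * From the renewal equation to the conditional expectation *)

Lemma probJ_ge0 n : 0 <= probJ p n.
Proof.
apply: sumr_ge0 => w _; apply: prodr_ge0 => j _; apply: prodr_ge0 => k _.
by have /andP[p0 p1] := p01 j; case: ifP => _; rewrite ?subr_ge0 ltW.
Qed.

Lemma rr_renewal n : rr p n = (n == 0%N)%:R + convolution (probJ p) (rr p) n.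
Proof.
have p1 j : p j != 1 by rewrite lt_eqF //; case/andP: (p01 j).
rewrite -prob_all_equalE // prob_all_equal_renewal; congr (_ + _).
by apply: eq_bigr => m _; rewrite prob_all_equalE.
Qed.

(** The moment equations are solved for B0, B1, B2. The nonnegativity, which is that of B2 / B1,
    later allows t / (t - 1) to be replaced by its square. *)
Lemma condE_tail_le (t A0 A1 A2 : R) : 1 < t -> 1 < A0 -> 0 < A1 ->
  series (rr p) @ \oo --> A0 -> series (fun n => n%:R * rr p n) @ \oo --> A1 ->
  series (fun n => (n ^ 2)%:R * rr p n) @ \oo --> A2 ->
  0 <= A2 / A1 - 2 * (A1 / A0) /\
  (condE_tail p t <= (t / (t - 1) * (A2 / A1 - 2 * (A1 / A0)))%:E)%E.
Proof.
move=> t1 A01 A10 hA0 hA1 hA2.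
have r0 n : 0 <= rr p n by exact: rr_ge0.
have J0 : probJ p 0 = 0.
  by rewrite /probJ big_pred0 // => w; rewrite /first_rencontre_at.
have [B0 [B1 [B2 [hB0 hB1 hB2 [E0 E1 E2]]]]] :=
  renewal_moments r0 probJ_ge0 J0 rr_renewal hA0 hA1 hA2.
have A00 : A0 != 0 by rewrite gt_eqF //; lra.
have A0' : 0 < A0 by lra.
have B0E : B0 = 1 - A0^-1.
  by apply: (mulIf A00); rewrite mulrBl mulVf // mul1r; move: E0; move: (B0 * A0) => x; lra.
have B1E : B1 = A1 / A0 ^+ 2.
  apply: (mulIf A00); rewrite (_ : _ / _ * A0 = A1 * A0^-1); last by field.
  have : B1 * A0 = A1 - B0 * A1 by rewrite {1}E1 addrK.
  by rewrite B0E => ->; ring.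
have B2E : B2 = A2 / A0 ^+ 2 - 2 * (A1 ^+ 2 / A0 ^+ 3).
  apply: (mulIf A00).
  have : B2 * A0 = A2 - B0 * A2 - 2 * (B1 * A1) by rewrite {1}E2; ring.
  by rewrite B0E B1E => ->; field.
have B00 : 0 < B0 by rewrite B0E subr_gt0 invf_lt1.
have B10 : 0 < B1 by rewrite B1E divr_gt0 // exprn_gt0.
have [Z [G [hZ hG ZG]]] := tail_mean_le probJ_ge0 t1 B00 B10 hB0 hB1 hB2.
have -> : A2 / A1 - 2 * (A1 / A0) = B2 / B1.
  by rewrite B2E B1E; field; rewrite A00 gt_eqF.
split.
  rewrite divr_ge0 ?(ltW B10) //; apply: (cvg_series_ge0 _ hB2) => n.
  by rewrite mulr_ge0 ?probJ_ge0.
have muE : muJ p = (B1 / B0)%:E.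
  rewrite /muJ /probJfin /expJfin (nneseries_EFin probJ_ge0 hB0).
  by rewrite (nneseries_EFin _ hB1) // => n; rewrite mulr_ge0 ?probJ_ge0.
rewrite /condE_tail muE -EFinM.
have sZ : (\sum_(0 <= n <oo)
    (if (B1 / B0 * t^-1)%:E < (n%:R)%:E then (n%:R * probJ p n)%:E else 0))%E = Z%:E.
  rewrite -(nneseries_EFin _ hZ) => [|n]; last first.
    by case: ifP => // _; rewrite mulr_ge0 ?probJ_ge0.
  by apply: eq_eseriesr => n _; rewrite lte_fin; case: ifP.
have sG : (\sum_(0 <= n <oo)
    (if (B1 / B0 * t^-1)%:E < (n%:R)%:E then (probJ p n)%:E else 0))%E = G%:E.
  rewrite -(nneseries_EFin _ hG) => [|n]; last by case: ifP => // _; rewrite probJ_ge0.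
  by apply: eq_eseriesr => n _; rewrite lte_fin; case: ifP.
by rewrite sZ sG lee_fin.
Qed.

End Assembly.

Theorem theorem18 (R : realType) (d : nat) (p : 'I_d -> R) (t l1 l2 : R) :
  (3 <= d)%N ->
  (forall j, 0 < p j < 1) ->
  1 < t ->
  0 < l1 < 1 -> 0 < l2 < 1 ->
  ((exists i j, p i != p j) \/ (6 <= d)%N) ->
  exists lim_val : \bar R,
    ((fun x => (bound_fun p l1 l2 x)%:E) @ 1^'- --> lim_val) /\
    (condE_tail p t <= ((t ^+ 2 / (t - 1) ^+ 2)%:E * lim_val)%E)%E.
Proof.
move=> d3 p01 t1 l101 l201 hpd.
have d0 : (0 < d)%N by apply: leq_trans d3.
have dE : 3 <= d%:R :> R by rewrite ler_nat.
have t0 : 0 < t - 1 by lra.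
have [T1 T1iff] := TT_le1_if d0 p01.
have T1d : TT p = 1 -> 6 <= d%:R :> R.
  move=> /eqP; rewrite T1iff => /forallP pc; rewrite ler_nat.
  case: hpd => [[i [j]]|//]; by rewrite (eqP (forallP (pc i) j)) eqxx.
have ltT : TT p < 1 \/ TT p = 1.
  by move: T1; rewrite le_eqVlt => /predU1P[->|]; [right|left].
have cv1 N : cvgn (fun m => \sum_(N <= n < m) rr_majorant p (- ((d%:R - 1) / 2)) n).
  apply: is_cvg_rr_majorant p01 _ _ _; case: ltT => h; [left|right]; split=> //; first lra.
  by have := T1d h; lra.
have cv3 N : cvgn (fun m => \sum_(N <= n < m) rr_majorant p (- ((d%:R - 3) / 2)) n).
  apply: is_cvg_rr_majorant p01 _ _ _; case: ltT => h; [left|right]; split=> //; first lra.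
  by have := T1d h; lra.
have hUB := UB_phi_left_limit p01 (cv1 (Nc (alphaP p) l1)).
have hLB := LB_dphi_left_limit p01 (cv3 (Lc (alphaP p) l2)).
have UB0 := UB_phi1_ge0 d3 p01 l101 (cv1 _).
have LB0 := LB_dphi1_gt0 d3 p01 l201 (cv3 _).
have hLBV : (LB_dphi p x l2)^-1 @[x --> 1^'-] --> (LB_dphi p 1 l2)^-1.
  by apply: cvgV => //; rewrite gt_eqF.
have hratio : LB_dphi p x l2 / (1 + UB_phi p x l1) @[x --> 1^'-] -->
    LB_dphi p 1 l2 / (1 + UB_phi p 1 l1).
  apply: cvgM => //; apply: cvgV; first by rewrite gt_eqF //; lra.
  by apply: cvgD => //; exact: cvg_cst.
(* The exponent -(d - 5)/2 is at most -3/2 exactly when d >= 8. *)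
have [fin|[T1' d8]] : (TT p < 1 \/ 8 <= d%:R :> R) \/ (TT p = 1 /\ d%:R <= 7 :> R).
  case: ltT => h; first by left; left.
  have [d8|d8] := leqP 8 d; first by left; right; rewrite ler_nat.
  by right; split=> //; rewrite ler_nat -ltnS.
- have cv5 N : cvgn (fun m => \sum_(N <= n < m) rr_majorant p (- ((d%:R - 5) / 2)) n).
    apply: is_cvg_rr_majorant p01 _ _ _.
    case: ltT => h; [left|right]; split=> //; first lra.
    by case: fin => h'; lra.
  have hUB2 := UB_dphi2_left_limit p01 (cv5 (Nc (alphaP p) l1)).
  exists (bound_fun p l1 l2 1)%:E; split.
    apply: cvg_EFin; first exact: nearW.
    by apply: cvgB => //; apply: cvgM.
  have [A0 [A1 [A2 [hA0 hA1 hA2 [A01 UA0 LA1 UA2]]]]] := rr_moments d3 p01 l101 l201 cv1 cv3 cv5.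
  have A10 : 0 < A1 by apply: lt_le_trans LA1.
  have [X0 hX] := condE_tail_le d3 p01 t1 A01 A10 hA0 hA1 hA2.
  apply: (le_trans hX); rewrite -EFinM lee_fin -expr_div_n expr2.
  have tt : 0 < t / (t - 1) by rewrite divr_gt0 //; lra.
  have tt1 : 1 <= t / (t - 1) by rewrite ler_pdivlMr //; lra.
  rewrite -(mulrA (t / (t - 1))) (ler_wpM2l (ltW tt)) //.
  have A20 : 0 <= A2.
    by apply: (cvg_series_ge0 _ hA2) => n; rewrite mulr_ge0 ?rr_ge0.
  have h1 : A2 / A1 <= UB_dphi2 p 1 l1 / LB_dphi p 1 l2.
    by rewrite ler_pM ?invr_ge0 ?(ltW A10) // lef_pV2.
  have h2 : LB_dphi p 1 l2 / (1 + UB_phi p 1 l1) <= A1 / A0.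
    by rewrite ler_pM ?invr_ge0 ?(ltW LB0) ?lef_pV2 ?posrE //; lra.
  have h3 : 0 <= A1 / A0 by rewrite divr_ge0 ?(ltW A10) //; lra.
  (* One of the two terms A1 / A0 is matched with LB / (1 + UB), the other is dropped as
     nonnegative. *)
  have h4 : A2 / A1 - 2 * (A1 / A0) <= bound_fun p l1 l2 1 by rewrite /bound_fun; lra.
  apply: (le_trans h4); rewrite ler_peMl //; exact: le_trans h4.
exists +oo%E; split; last first.
  by rewrite gt0_muley ?leey // lte_fin divr_gt0 // exprn_gt0 //; lra.
apply/cvgeryP/cvgryPge => A.
have e5 : -1 <= (- ((d%:R - 5) / 2) : R) <= 0 by have := T1d T1'; lra.
have K0 := UB_const_gt0 p01 l101.
set r := (LB_dphi p 1 l2)^-1 in hLBV.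
have r0 : 0 < r by rewrite invr_gt0.
set g := LB_dphi p 1 l2 / _ in hratio.
(* Chosen so that U times r / 2, a lower bound of the quotient near 1, is |A| + |g| + 1; the
   subtracted term stays below g + 1, so the difference exceeds A. *)
set U := (`|A| + `|g| + 1) * 2 / r.
have /cvgryPge/(_ (U / (Mc (alphaP p) l1 / Num.sqrt (2 * pi)) ^+ d.-1)) hU :=
  tail_pred_left_pinfty p01 (Nc_gt0 p l1) T1' e5.
have {}hLBV : \forall x \near 1^'-, r / 2 < (LB_dphi p x l2)^-1.
  by apply: cvgr_gt hLBV _ _; lra.
have {}hratio : \forall x \near 1^'-, LB_dphi p x l2 / (1 + UB_phi p x l1) < g + 1.
  by apply: cvgr_lt hratio _ _; lra.
near=> x.
have x0 : 0 <= x by near: x; exact: nbhs_left_ge.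
have hx : U <= UB_dphi2 p x l1.
  rewrite /UB_dphi2 -[leLHS]add0r lerD //.
    by apply: sumr_ge0 => n _; rewrite mulr_ge0 ?exprn_ge0 // mulr_ge0 // rr_ge0.
  by rewrite mulrC -ler_pdivrMr //; near: x; exact: hU.
have h1 : r / 2 < (LB_dphi p x l2)^-1 by near: x; exact: hLBV.
have h2 : LB_dphi p x l2 / (1 + UB_phi p x l1) < g + 1 by near: x; exact: hratio.
have Ur : `|A| + `|g| + 1 <= UB_dphi2 p x l1 / LB_dphi p x l2.
  rewrite (_ : _ + 1 = U * (r / 2)); last by rewrite /U; field; rewrite gt_eqF.
  rewrite ler_pM ?(ltW h1) //; last by rewrite divr_ge0 // ltW.
  by rewrite /U divr_ge0 ?(ltW r0) // mulr_ge0 // !addr_ge0.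
have := ler_norm A; have := ler_norm g; rewrite /bound_fun.
move: Ur h2; move: (_ / LB_dphi p x l2) (_ / (1 + _)) => y z; lra.
Unshelve. all: by end_near. Qed.
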